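(* Let $X$ be an a.s. non-empty random closed convex set in $\mathfrak{X}$. Then $$h_{\mathbf{m}(X|\mathcal{H})}(\zeta)\le \operatorname{ess\,inf}_{\mathcal{H}} h_X(\zeta),\qquad \zeta\in\mathcal{L}^0(\mathfrak{X}^*,\mathcal{H}),$$ and $$\mathbf{m}(X|\mathcal{H})=\bigcap_{\zeta\in\mathcal{L}^0(\mathfrak{X}^*,\mathcal{F})}\Big\{x\in\mathfrak{X}:\ \operatorname{ess\,inf}_{\mathcal{H}}\big(h_X(\zeta)-\langle\zeta,x\rangle\big)\geq0\Big\}.$$ If $\{\zeta_n,n\geq1\}\subset\mathcal{L}^0(\mathfrak{X}^*,\mathcal{F})$ is a sequence such that $X=\bigcap_{n\geq1}\{x\in\mathfrak{X}:\ \langle\zeta_n,x\rangle\leq h_X(\zeta_n)\}$, then $$\mathbf{m}(X|\mathcal{H})=\bigcap_{n\geq1}\Big\{x\in\mathfrak{X}:\ \operatorname{ess\,inf}_{\mathcal{H}}\big(h_X(\zeta_n)-\langle\zeta_n,x\rangle\big)\geq0\Big\}.$$ If $X$ is weakly compact, then $$\mathbf{m}(X|\mathcal{H})=\bigcap_{u\in\mathfrak{X}^*_0}\{x\in\mathfrak{X}:\ \langle u,x\rangle\leq\operatorname{ess\,inf}_{\mathcal{H}} h_X(u)\},$$ and the intersection can be taken over all $u\in\mathfrak{X}^*$.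
   Context: $\mathfrak{X}$ is a separable real Banach space with Borel $\sigma$-algebra $\mathcal{B}(\mathfrak{X})$; $(\Omega,\mathcal{F},\mathbf{P})$ is a complete probability space and $\mathcal{H}$ is a sub-$\sigma$-algebra of $\mathcal{F}$. An $\mathcal{H}$-measurable random set is a set-valued function $\omega\mapsto X(\omega)\subset\mathfrak{X}$ whose graph $\{(\omega,x):\ x\in X(\omega)\}$ belongs to $\mathcal{H}\otimes\mathcal{B}(\mathfrak{X})$; ''random set'' without further specification means $\mathcal{F}$-measurable; it is said to be closed (convex) if $X(\omega)$ is closed (convex) for almost all $\omega$. $\mathfrak{X}^*$ is the dual space with pairing $\langle u,x\rangle$, equipped with the $\sigma(\mathfrak{X}^*,\mathfrak{X})$-topology, and $\mathfrak{X}^*_0$ is a countable total subset of $\mathfrak{X}^*$ (total: it separates the points of $\mathfrak{X}$), fixed in advance; such a set always exists. $\mathcal{L}^0(\mathfrak{X}^*,\mathcal{F})$ (respectively $\mathcal{L}^0(\mathfrak{X}^*,\mathcal{H})$) is the family of random elements $\zeta$ in $\mathfrak{X}^*$, that is, maps such that $\langle\zeta,x\rangle$ is an $\mathcal{F}$-measurable (respectively $\mathcal{H}$-measurable) random variable for all $x\in\mathfrak{X}$. The support function is $h_X(u)=\sup\{\langle u,x\rangle:\ x\in X\}$, $u\in\mathfrak{X}^*$, set to be $-\infty$ for empty $X$; $h_X(\zeta)$ denotes the random variable $\omega\mapsto h_{X(\omega)}(\zeta(\omega))$. For a random variable $\eta$ with values in $[-\infty,\infty]$, $\operatorname{ess\,inf}_{\mathcal{H}}\eta$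 is the conditional essential infimum: the largest $\mathcal{H}$-measurable extended-real-valued random variable that is a.s. less than or equal to $\eta$. The conditional core $\mathbf{m}(X|\mathcal{H})$ is the largest $\mathcal{H}$-measurable random set $X'$ such that $X'\subset X$ a.s.; for a random closed set $X$ it exists and is a random closed set (possibly empty).
   Formalization: In the weakly compact case, the equality over X*_0 also assumes that X*_0 is closed under rational linear combinations; for a merely total set it fails (space R, X*_0={id}, X=[0,1]: the core is [0,1], the right-hand side is (-∞,1]). *)

(* Defs.v *)
From HB Require Import structures.
From mathcomp Require Export all_boot all_order all_algebra.
From mathcomp Require Export all_classical all_reals all_analysis.
From mathcomp Require Export measurable_realfun.
Export numFieldNormedType.Exports.

Set Implicit Arguments.
Unset Strict Implicit.
Unset Printing Implicit Defensive.

Import Order.TTheory GRing.Theory Num.Theory.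
Local Open Scope classical_set_scope.
Local Open Scope ring_scope.

Definition separable_space (T : topologicalType) : Prop :=
  exists2 D : set T, countable D & dense D.

Record dual (R : realType) (E : normedModType R) := Dual {
  dual_fun :> {linear E -> R^o} ;
  dual_continuous : continuous dual_fun }.

HB.instance Definition _ (R : realType) (E : normedModType R) :=
  gen_eqMixin (dual E).
HB.instance Definition _ (R : realType) (E : normedModType R) :=
  gen_choiceMixin (dual E).

Definition weakly_compact (R : realType) (E : normedModType R) (A : set E) :=
  @compact
    (initial_topology (fun x : E => (fun u => u x) : {ptws dual E -> R^o})) A.

Definition borel (T : topologicalType) := g_sigma_algebraType (@open T).

Definition total (R : realType) (E : normedModType R) (U : set (dual E)) :=
  forall x y : E, (forall u, U u -> u x = u y) -> x = y.

(* Separating points is not enough for the half-spaces {x | u x <= h_X u},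
   u in U, to determine a weakly compact convex X: in E = R the set U = {id} is
   total, but gives ]-oo, 1] for X = [0, 1].  Closing a countable total set under
   rational linear combinations keeps it countable and total, and suffices. *)
Definition rat_subspace (R : realType) (E : normedModType R)
    (U : set (dual E)) :=
  forall (q : rat) u v, U u -> U v ->
    exists2 w, U w & forall x : E, w x = ratr q * u x + v x.

(* The value at the empty set is -oo. *)
Definition support (R : realType) (E : normedModType R) (A : set E)
    (u : dual E) : \bar R := ereal_sup [set (u x)%:E | x in A].

(* A sigma-algebra on Omega is given as a set G of subsets, so that the same
   definitions serve the full sigma-algebra (G := measurable) and a
   sub-sigma-algebra. *)
Definition sub_sigma_algebra_of (d : measure_display)
    (Omega : measurableType d) (H : set (set Omega)) :=
  sigma_algebra [set: Omega] H /\ H `<=` measurable.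

Definition random_set (d : measure_display) (Omega : measurableType d)
    (R : realType) (E : completeNormedModType R)
    (G : set (set Omega)) (X : Omega -> set E) :=
  measurable ([set p | X p.1 p.2] : set (g_sigma_algebraType G * borel E)).

Definition random_vector (d : measure_display) (Omega : measurableType d)
    (R : realType) (E : completeNormedModType R)
    (G : set (set Omega)) (gamma : Omega -> E) :=
  measurable_fun [set: g_sigma_algebraType G]
    (gamma : g_sigma_algebraType G -> borel E).

Definition L0_dual (d : measure_display) (Omega : measurableType d)
    (R : realType) (E : completeNormedModType R)
    (G : set (set Omega)) : set (Omega -> dual E) :=
  [set zeta | forall x : E, measurable_fun [set: g_sigma_algebraType G]
                ((fun w => zeta w x) : g_sigma_algebraType G -> R)].

Definition is_cond_core (d : measure_display) (Omega : measurableType d)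
    (R : realType) (P : probability Omega R) (E : completeNormedModType R)
    (H : set (set Omega)) (X M : Omega -> set E) :=
  [/\ random_set H M,
      {ae P, forall w, M w `<=` X w} &
      forall M' : Omega -> set E, random_set H M' ->
        {ae P, forall w, M' w `<=` X w} -> {ae P, forall w, M' w `<=` M w}].

(* e is a version of the conditional essential infimum of eta given H. *)
Definition is_cond_essinf (d : measure_display) (Omega : measurableType d)
    (R : realType) (P : probability Omega R)
    (H : set (set Omega)) (eta e : Omega -> \bar R) :=
  [/\ measurable_fun [set: g_sigma_algebraType H]
        (e : g_sigma_algebraType H -> \bar R),
      {ae P, forall w, (e w <= eta w)%E} &
      forall e' : Omega -> \bar R,
        measurable_fun [set: g_sigma_algebraType H]
          (e' : g_sigma_algebraType H -> \bar R) ->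
        {ae P, forall w, (e' w <= eta w)%E} ->
        {ae P, forall w, (e' w <= e w)%E}].

(* phi is a version of x |-> essinf_H (xi x).  Since each essinf_H (xi x) is
   only defined up to a null set depending on x, the random set
   {x | 0 <= essinf_H (xi x)} makes sense only for a version that is jointly
   measurable and correct at every H-measurable random point; such a version is
   unique up to a null set of w common to all x. *)
Definition is_cond_essinf_field (d : measure_display) (Omega : measurableType d)
    (R : realType) (P : probability Omega R) (E : completeNormedModType R)
    (H : set (set Omega)) (xi phi : Omega -> E -> \bar R) :=
  measurable_fun [set: g_sigma_algebraType H * borel E]
    ((fun p => phi p.1 p.2) : g_sigma_algebraType H * borel E -> \bar R) /\
  forall gamma : Omega -> E, random_vector H gamma ->
    is_cond_essinf P H (fun w => xi w (gamma w)) (fun w => phi w (gamma w)).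

(* Intersection of a possibly uncountable family of random sets, each given up
   to a null set of its own (a pointwise intersection would depend on the
   versions): M is a.s. contained in every member, and a.s. contains the
   intersection of some countable subfamily.  This determines M a.s.; for
   countable D it says that M is a.s. the pointwise intersection. *)
Definition is_ae_bigcap (d : measure_display) (Omega : measurableType d)
    (R : realType) (P : probability Omega R) (E : completeNormedModType R)
    (I : Type) (D : set I) (S : I -> Omega -> set E) (M : Omega -> set E) :=
  (forall i, D i -> {ae P, forall w, M w `<=` S i w}) /\
  exists D' : set I, [/\ countable D', D' `<=` D &
    {ae P, forall w, \bigcap_(i in D') S i w `<=` M w}].

(* Main.v *)
From HB Require Import structures.
Require Import Defs.
From mathcomp Require Import ring lra.

(**
All inclusions between random sets are reduced to statements about measurable
selections.  The tool is Aumann's theorem ([aumann_selection]): a set G in the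
product of H and the Borel sets of E admits an H-measurable selection over all
of its projection, up to a null set.  It is applied to H, which need not contain
the null sets, and to the full complete sigma-algebra, where it also yields
measurability of projections.  The proof represents G as a Suslin set
([measurable_suslin]), encodes points of E by approximating sequences, and then
follows, by least choices, a branch of the measurable hulls of the sets of
parameters w that extend a given finite sequence ([suslin_selection]).

Upper bounds for the core M.  If the set of (w, x) with x in M w that violate an
inequality had a non-negligible projection, it would have an H-measurable
selection g over an event D of H with P D > 0.  On D the point g w lies in
M w, hence in X w, so that <zeta, g> <= h_X(zeta) there; the function equal to
<zeta, g> on D and to -oo elsewhere is then an H-measurable minorant of
h_X(zeta), and lies below the conditional essential infimum, a contradiction.
The same argument with the value 0 on D treats the fields
x |-> essinf_H (h_X(zeta) - <zeta, x>).  See [support_subset_essinf] and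
[subset_essinf_field].

Lower bounds for the core.  An intersection M' of countably many sets
{0 <= phi_n} is an H-measurable random set, and every H-measurable selection of
M' takes its values in X, because phi_n at that selection is an essential
infimum and so lies below h_X(zeta_n) - <zeta_n, .>.  As X is closed, selecting
from the intersections of M' with balls of a countable base gives M' <= X
([random_set_subset_closed]), and maximality of the core gives M' <= M.

Countably many half-spaces suffice ([random_halfspaces]).  For q in a countable
dense set and r = 1/(m+1), on the event that X stays at distance r from q, a
functional of norm at most 1 separating X from q by r is a linear minorant of
the gauge p(x) = inf {|x - t(k - q)| - t r | t >= 0, k in X}.  Hahn-Banach is
made measurable by an explicit construction: tilting a sublinear p in direction
z, p^z(x) = inf_n (p(x + n z) - n p(z)), produces a smaller sublinear functional
that is linear along z; the infimum of the successive tilts along a dense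
sequence is linear, and depends measurably on the parameter.

Weakly compact X.  Constant functionals suffice, because a point outside a weakly
compact convex set is separated from it by an element of any total rational
subspace of the dual ([weak_compact_separation]).  *)

Set Implicit Arguments.
Unset Strict Implicit.
Unset Printing Implicit Defensive.
Import Order.TTheory GRing.Theory Num.Theory.
Local Open Scope classical_set_scope.
Local Open Scope ring_scope.

(** * Selecting branches through a Suslin scheme *)

Lemma bigcup_countType_nat (T : Type) (I : countType) (F : I -> set T) :
  \bigcup_i F i = \bigcup_n oapp F set0 (unpickle n).
Proof.
apply/seteqP; split => x.
  by case=> i _ Fix; exists (pickle i); rewrite //= pickleK.
by case=> n _; case: (unpickle n) => //= i Fix; exists i.
Qed.

Lemma measurable_first_hit d (T : measurableType d) (F : nat -> set T) :
  (forall i, measurable (F i)) ->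
  exists f : T -> nat, (forall i, measurable [set w | f w = i]) /\
    forall w, (\bigcup_i F i) w -> F (f w) w.
Proof.
move=> mF; pose f w := xget 0%N [set i | seqDU F i w].
have fP w i : seqDU F i w -> f w = i.
  move=> Fiw; rewrite /f; case: xgetP => [j _ Fjw|/(_ i)//].
  by apply: (@trivIset_seqDU _ F j i I I); exists w.
exists f; split=> [i|w]; last first.
  by rewrite seqDU_bigcup_eq => -[i _ Fiw]; rewrite (fP _ _ Fiw); exact: subset_seqDU Fiw.
have mD : measurable (~` \bigcup_i F i).
  exact/measurableC/bigcupT_measurable.
rewrite (_ : [set w | f w = i] =
  seqDU F i `|` (if i == 0%N then ~` \bigcup_i F i else set0)).
  apply: measurableU; last by case: ifP.
  apply: measurableD => //; exact: bigsetU_measurable.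
apply/seteqP; split => [w /= fwi|w /= [/fP//|]].
  have [[j _ Fjw]|nFw] := pselect ((\bigcup_i seqDU F i) w).
    by left; rewrite -fwi (fP _ _ Fjw).
  right; move: fwi; rewrite /f; case: xgetP => [j _ /= Fjw _|_ <- /=].
    by exfalso; apply: nFw; exists j.
  by rewrite seqDU_bigcup_eq.
case: eqP => // -> nFw; rewrite /f; case: xgetP => // j _ /= Fjw.
by exfalso; apply: nFw; rewrite seqDU_bigcup_eq; exists j.
Qed.

(** Continuity on the Baire space of sequences, for a discrete codomain. *)
Definition locally_constant (A : Type) (f : (nat -> nat) -> A) :=
  forall s, exists m, forall t, (forall i, (i < m)%N -> t i = s i) -> f t = f s.

(** The only property of a finite measure that the Suslin operation needs: modulo
    N, each set has a least measurable superset. *)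
Definition has_hulls d (T : measurableType d) (N : set (set T)) :=
  forall S : set T, exists B, [/\ measurable B, S `<=` B &
    forall B', measurable B' -> S `<=` B' -> N (B `\` B')].

Definition null_sigma_ideal (T : Type) (N : set (set T)) :=
  forall F : nat -> set T, (forall n, N (F n)) -> N (\bigcup_n F n).

(** Let S s be the set of w that lie in all C n t for some t extending the finite
    sequence s, and B s its measurable hull.  As S s is the union of the
    S (rcons s i), the set B s is covered by the B (rcons s i) up to a null set,
    and as S s is included in every C n that is constant on the extensions of s,
    so is B s up to a null set.  Off the countably many null sets, any w in
    B [::] can be followed along a branch of hulls, which then lies in all C n;
    taking the least possible index at each stage makes the branch measurable. *)
Lemma suslin_selection d (T : measurableType d) (N : set (set T))
    (C : nat -> (nat -> nat) -> set T) :
  has_hulls N -> null_sigma_ideal N ->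
  (forall n s, measurable (C n s)) -> (forall n, locally_constant (C n)) ->
  exists (D Z : set T) (b : T -> nat -> nat),
    [/\ measurable D, N Z,
        forall s w, (forall n, C n s w) -> D w \/ Z w,
        forall w, D w -> forall n, C n (b w) w &
        forall i j, measurable [set w | b w i = j]].
Proof.
move=> hull NU mC lC.
have N0 : N set0.
  by have [B [mB _ /(_ B mB)]] := hull set0; rewrite setDv; apply.
pose cyl (s : seq nat) := [set t : nat -> nat | mkseq t (size s) = s].
have cyl_nth s : cyl s (nth 0%N s) by rewrite /cyl /= mkseq_nth.
pose S s := [set w | exists2 t, cyl s t & forall n, C n t w].
have /choice[B BP] : forall s, exists B, [/\ measurable B, S s `<=` B &
    forall B', measurable B' -> S s `<=` B' -> N (B `\` B')].
  by move=> s; exact: hull.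
have mB s : measurable (B s) by case: (BP s).
have SB s : S s `<=` B s by case: (BP s).
have NB s B' : measurable B' -> S s `<=` B' -> N (B s `\` B').
  by case: (BP s) => _ _; apply.
(* Z1 s: points of the hull of s from which no one-step extension is possible.
   Z2 s n: points of the hull outside the value of C n on extensions of s. *)
pose Z1 s := B s `\` \bigcup_i B (rcons s i).
pose const s n := forall t, cyl s t -> C n t = C n (nth 0%N s).
pose Z2 s n := if `[< const s n >] then B s `\` C n (nth 0%N s) else set0.
have NZ1 s : N (Z1 s).
  apply: NB; first exact: bigcupT_measurable.
  move=> w [t st Ctw]; exists (t (size s)) => //; apply: SB; exists t => //.
  by rewrite /cyl /= size_rcons mkseqS st.
have NZ2 s n : N (Z2 s n).
  rewrite /Z2; case: ifPn => // /asboolP cs; apply: NB => // w [t st Ctw].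
  by rewrite -(cs t).
have mZ2 s n : measurable (Z2 s n).
  by rewrite /Z2; case: ifPn => // _; apply: measurableD.
pose W s k := if k is n.+1 then Z2 s n else Z1 s.
pose Z := \bigcup_s \bigcup_k W s k.
have NZ : N Z.
  rewrite /Z bigcup_countType_nat; apply: (NU) => n.
  by case: (unpickle n) => //= s; apply: NU => -[|k] /=.
have mZ : measurable Z.
  rewrite /Z bigcup_countType_nat; apply: bigcupT_measurable => n.
  case: (unpickle n) => //= s; apply: bigcupT_measurable => -[|k] //=.
  by apply: measurableD => //; exact: bigcupT_measurable.
have /choice[next nextP] : forall s, exists f : T -> nat,
    (forall i, measurable [set w | f w = i]) /\
    forall w, (\bigcup_i B (rcons s i)) w -> B (rcons s (f w)) w.
  by move=> s; exact: measurable_first_hit.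
pose pre w := fix pre n :=
  if n is m.+1 then rcons (pre m) (next (pre m) w) else [::].
pose b w i := next (pre w i) w.
have preE w n : mkseq (b w) n = pre w n.
  by elim: n => //= n IHn; rewrite mkseqS IHn.
exists (B [::] `\` Z), Z, b; split => //.
- exact: measurableD.
- move=> s w Csw; have [Zw|nZw] := pselect (Z w); [by right|left].
  by split=> //; apply: SB; exists s.
- move=> w [Bw nZw].
  have Bpre n : B (pre w n) w.
    elim: n => //= n IHn; apply: (nextP _).2; apply: contrapT => nB.
    by apply: nZw; exists (pre w n) => //; exists 0%N.
  move=> n; have [m mP] := lC n (b w).
  have agree t : cyl (pre w m) t -> C n t = C n (b w).
    move=> tm; apply: mP => i im; have := congr1 (nth 0%N ^~ i) tm.
    by rewrite -preE size_mkseq !nth_mkseq.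
  have cs : const (pre w m) n.
    by move=> t tm; rewrite (agree t)// agree//; exact: cyl_nth.
  rewrite -(agree _ (cyl_nth _)); apply: contrapT => nC.
  apply: nZw; exists (pre w m) => //; exists n.+1 => //=.
  by rewrite /Z2; case: asboolP.
move=> i j.
have mpre n s : measurable [set w | pre w n = s].
  elim: n s => [|n IHn] s.
    have [->|s0] := eqVneq s [::].
      by rewrite (_ : [set _ | _] = setT)//; apply/seteqP.
    rewrite (_ : [set _ | _] = set0)//; apply/seteqP; split=> //= w /eqP.
    by rewrite eq_sym (negbTE s0).
  case/lastP: s => [|s k].
    rewrite (_ : [set _ | _] = set0)//; apply/seteqP; split=> //= w.
    by move=> /= /(congr1 size); rewrite size_rcons.
  rewrite (_ : [set _ | _] = [set w | pre w n = s] `&` [set w | next s w = k]).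
    by apply: measurableI => //; apply: (nextP _).1.
  by apply/seteqP; split=> w /= => [/rcons_inj[-> <-]//|[-> ->]].
rewrite (_ : [set w | b w i = j] =
  \bigcup_s ([set w | pre w i = s] `&` [set w | next s w = j])).
  rewrite bigcup_countType_nat; apply: bigcupT_measurable => n.
  case: (unpickle n) => //= s; apply: measurableI => //.
  exact: (nextP _).1.
by apply/seteqP; split=> w /= => [bw|[s _ [<-]]//]; exists (pre w i).
Qed.

(** * Suslin sets in a product with a complete metric space *)

(** A decoding of pairs of natural numbers that is defined on all of nat. *)
Definition natpair (k : nat) : nat * nat := odflt (0, 0)%N (unpickle k).

Lemma natpairK i j : natpair (pickle (i, j)) = (i, j).
Proof. by rewrite /natpair pickleK. Qed.

Section locally_constant_lemmas.
Variables (A B C : Type).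

Lemma locally_constant_nth j : locally_constant (fun s : nat -> nat => s j).
Proof. by move=> s; exists j.+1 => t; apply. Qed.

Lemma locally_constant_pair (h : A -> B -> C) f g :
  locally_constant f -> locally_constant g ->
  locally_constant (fun s => h (f s) (g s)).
Proof.
move=> lf lg s; have [m mP] := lf s; have [n nP] := lg s.
exists (maxn m n) => t ts; rewrite mP ?nP// => i im; apply: ts.
  by rewrite leq_max im orbT.
by rewrite leq_max im.
Qed.

Lemma locally_constant_reindex (e g : nat -> nat) (f : (nat -> nat) -> A) :
  locally_constant f -> locally_constant (fun s => f (fun j => g (s (e j)))).
Proof.
move=> lf s; have [m mP] := lf (fun j => g (s (e j))).
exists (\max_(j < m) (e j).+1)%N => t ts; apply: mP => i im.
rewrite ts//; exact: (@leq_bigmax _ (fun j : 'I_m => (e j).+1) (Ordinal im)).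
Qed.

Lemma locally_constant_head (f : nat -> (nat -> nat) -> A) :
  (forall k, locally_constant (f k)) ->
  locally_constant (fun s => f (s 0%N) (fun j => s j.+1)).
Proof.
move=> lf s; have [m mP] := lf (s 0%N) (fun j => s j.+1).
by exists m.+1 => t ts; rewrite ts// mP// => i im; rewrite ts.
Qed.

End locally_constant_lemmas.

Section metric.
Variables (R : realType).

Lemma natSinv_lt (e : R) : 0 < e -> exists N, forall n, (N <= n)%N -> n.+1%:R^-1 < e.
Proof.
move=> e0; have [N _ NP] := near_infty_natSinv_lt (PosNum e0).
by exists N => n Nn; exact: NP.
Qed.

Lemma closed_approx (E : normedModType R) (F : set E) x : closed F ->
  (forall e : R, 0 < e -> exists2 y, F y & `|x - y| < e) -> F x.
Proof.
move=> cF Fx; apply: cF => B /nbhs_ballP[e /= e0 eB].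
have [y Fy xy] := Fx _ e0.
by exists y; split=> //; apply: eB; rewrite -ball_normE.
Qed.

Lemma closed_far_points (E : normedModType R) (U : set E) n :
  closed [set x | forall y, ~ U y -> n.+1%:R^-1 <= `|x - y|].
Proof.
rewrite (_ : [set _ | _] =
  \bigcap_(y in ~` U) ((fun x => `|x - y|) @^-1` [set t | n.+1%:R^-1 <= t])).
  apply: closed_bigI => y _; apply: preimage_closed; last exact: closed_ge.
  by move=> x _; apply: cvg_norm; apply: cvgB; [exact: cvg_id|exact: cvg_cst].
by apply/seteqP; split => x.
Qed.

(** With [closed_far_points], this makes an open set a countable union of closed
    sets. *)
Lemma open_bigcup_far (E : normedModType R) (U : set E) : open U ->
  U = \bigcup_n [set x | forall y, ~ U y -> n.+1%:R^-1 <= `|x - y|].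
Proof.
move=> oU; apply/seteqP; split=> [x Ux|x [n _ /= xn]]; last first.
  by apply: contrapT => /xn; rewrite subrr normr0 leNgt invr_gt0 ltr0Sn.
have /nbhs_ballP[e /= e0 eU] : nbhs x U by exact: open_nbhs_nbhs.
have [N NP] := natSinv_lt e0; exists N => //= y nUy.
rewrite leNgt; apply/negP => xy; apply: nUy; apply: eU.
by rewrite -ball_normE/=; apply: lt_trans xy _; exact: NP.
Qed.

Lemma separable_seq (E : normedModType R) : separable_space E ->
  exists q : nat -> E, forall x (e : R), 0 < e -> exists j, `|x - q j| < e.
Proof.
case=> D cD dD; have [D0|] := eqVneq D set0.
  have [] := dD setT; [by exists 0|exact: openT|].
  by move=> x; rewrite D0 => -[].
move: cD => /pfcard_geP[->|[q] _]; first by rewrite eqxx.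
exists q => x e e0.
have [] := dD (ball x e); [by exists x; exact: ballxx|exact: ball_open|].
move=> y [xy /(@surj _ _ _ _ q)[j _ qj]].
by exists j; rewrite qj; move: xy; rewrite -ball_normE.
Qed.

(** The form of completeness used to decode points: the rate of convergence is
    prescribed, so that being close to the limit is a condition on finitely many
    terms. *)
Lemma fast_cauchy_lim (E : completeNormedModType R) (u : nat -> E) :
  (forall i j, `|u i - u j| <= i.+1%:R^-1 + j.+1%:R^-1) ->
  exists x, forall m, `|x - u m| <= m.+1%:R^-1.
Proof.
move=> uP.
have /cauchy_cvgP ucvg : cauchy (u @ \oo).
  apply: cauchy_exP => e e0.
  have [N NP] := natSinv_lt (divr_gt0 e0 (ltr0Sn R 1)).
  exists (u N); exists N => // n /= Nn; rewrite -ball_normE/=.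
  apply: le_lt_trans (uP _ _) _.
  by rewrite [ltRHS]splitr; apply: ltrD; exact: NP.
exists (lim (u @ \oo)) => m.
suff lim_le (e : R) : 0 < e -> `|lim (u @ \oo) - u m| <= m.+1%:R^-1 + e.
  by apply/ler_addgt0Pr => e; exact: lim_le.
move=> e0.
have e20 := divr_gt0 e0 (ltr0Sn R 1).
have [N NP] := natSinv_lt e20.
have /cvgrPdist_lt/(_ _ e20)[K _ KP] := ucvg.
pose n := maxn N K.
apply: le_trans (ler_distD (u n) _ _) _.
have h1 := KP n (leq_maxr _ _); have h2 := NP n (leq_maxl _ _); have h3 := uP n m.
move: h1 h2 h3 => /=.
by move: `|_ - _| `|_ - _| (n.+1%:R^-1) (m.+1%:R^-1) => a b c r; lra.
Qed.

End metric.

Section suslin.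
Context d (T : measurableType d) (R : realType) (E : completeNormedModType R).

(** Results of the Suslin operation on rectangles with measurable first and closed
    second side.  Indexing by locally constant functions of the whole sequence,
    instead of by its finite prefixes, makes the closure under countable unions
    and intersections a matter of reindexing. *)
Definition suslin (G : set (T * E)) :=
  exists (A : nat -> (nat -> nat) -> set T) (F : nat -> (nat -> nat) -> set E),
  [/\ forall n s, measurable (A n s), forall n s, closed (F n s),
      forall n, locally_constant (A n), forall n, locally_constant (F n) &
      forall p, G p <-> exists s, forall n, A n s p.1 /\ F n s p.2].

Lemma suslin_rect (A : set T) (F : set E) :
  measurable A -> closed F -> suslin (A `*` F).
Proof.
move=> mA cF; exists (fun _ _ => A), (fun _ _ => F).
split=> //; try by move=> n s; exists 0%N.
by move=> p; split=> [[]|[s /(_ 0%N)]//]; exists id.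
Qed.

Lemma suslin_bigcap (G : nat -> set (T * E)) :
  (forall i, suslin (G i)) -> suslin (\bigcap_i G i).
Proof.
move=> /choice[A /choice[F AF]].
pose sub (i : nat) (s : nat -> nat) (j : nat) := s (pickle (i, j)).
exists (fun k s => A (natpair k).1 (natpair k).2 (sub (natpair k).1 s)).
exists (fun k s => F (natpair k).1 (natpair k).2 (sub (natpair k).1 s)).
split.
- by move=> n s; case: (AF (natpair n).1).
- by move=> n s; case: (AF (natpair n).1).
- move=> n; apply: (locally_constant_reindex (fun j => pickle (_, j)) id).
  by case: (AF (natpair n).1).
- move=> n; apply: (locally_constant_reindex (fun j => pickle (_, j)) id).
  by case: (AF (natpair n).1).
move=> p; split=> [Gp|[s sP] i _]; last first.
  case: (AF i) => _ _ _ _ /(_ p)[_]; apply; exists (sub i s) => n.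
  by have := sP (pickle (i, n)); rewrite natpairK.
have /choice[t tP] : forall i, exists s, forall n, A i n s p.1 /\ F i n s p.2.
  by move=> i; case: (AF i) => _ _ _ _ /(_ p)[]/(_ (Gp i I)).
exists (fun k => t (natpair k).1 (natpair k).2) => n.
rewrite (_ : sub _ _ = t (natpair n).1)//.
by apply/funext => j; rewrite /sub natpairK.
Qed.

Lemma suslin_bigcup (G : nat -> set (T * E)) :
  (forall i, suslin (G i)) -> suslin (\bigcup_i G i).
Proof.
move=> /choice[A /choice[F AF]].
exists (fun n s => A (s 0%N) n (fun j => s j.+1)).
exists (fun n s => F (s 0%N) n (fun j => s j.+1)).
split.
- by move=> n s; case: (AF (s 0%N)).
- by move=> n s; case: (AF (s 0%N)).
- move=> n; apply: (@locally_constant_head _ (fun k => A k n)) => k.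
  by case: (AF k).
- move=> n; apply: (@locally_constant_head _ (fun k => F k n)) => k.
  by case: (AF k).
move=> p; split=> [[i _ Gp]|[s sP]]; last first.
  exists (s 0%N) => //; case: (AF (s 0%N)) => _ _ _ _ /(_ p)[_]; apply.
  by exists (fun j => s j.+1).
case: (AF i) => _ _ _ _ /(_ p)[]/(_ Gp)[s sP] _.
by exists (fun j => if j is k.+1 then s k else i).
Qed.

Lemma sigma_algebra_bisuslin :
  sigma_algebra [set: T * E] [set G | suslin G /\ suslin (~` G)].
Proof.
have s0 : suslin set0 by rewrite -(@set0X _ _ setT); apply: suslin_rect.
have sT : suslin setT by rewrite -setXTT; apply: suslin_rect.
split; first by rewrite /= setC0.
  by move=> G [sG sCG]; rewrite setTD /= setCK.
move=> F sF; split; first by apply: suslin_bigcup => i; case: (sF i).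
by rewrite setC_bigcup; apply: suslin_bigcap => i; case: (sF i).
Qed.

(** The sets that are Suslin together with their complement form a sigma-algebra.
    It contains the measurable rectangles because, E being metric, both open and
    closed sets are countable unions of closed ones. *)
Lemma measurable_suslin (G : set (T * borel E)) :
  measurable G -> suslin G.
Proof.
suff H : measurable `<=` [set G : set (T * borel E) | suslin G /\ suslin (~` G)].
  by move=> /H[].
have sK := sigma_algebra_bisuslin.
rewrite /measurable /= /g_sigma_preimageU; apply: smallest_sub => // _ [] [A mA <-]; rewrite setTI.
  by split; [rewrite -setXT|rewrite preimage_setC -setXT];
    apply: suslin_rect => //; exact: measurableC.
pose K := [set B : set E | [set G | suslin G /\ suslin (~` G)] (snd @^-1` B)].
suff /(_ A mA) : (@measurable _ (borel E)) `<=` K by [].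
apply: smallest_sub.
  case: sK => K0 KC KU; split=> //.
    by move=> B /KC; rewrite !setTD.
  by move=> F /KU.
move=> U oU; rewrite /K /=; split; last first.
  by rewrite preimage_setC -setTX; apply: suslin_rect => //; exact: open_closedC.
rewrite (open_bigcup_far oU) preimage_bigcup; apply: suslin_bigcup => n.
by rewrite -setTX; apply: suslin_rect => //; exact: closed_far_points.
Qed.

End suslin.

(** * Measurable selection *)

Lemma measurable_fun_borel d (T : measurableType d) (R : realType)
    (E : completeNormedModType R)
    (g : T -> borel E) :
  (forall U : set E, open U -> measurable (g @^-1` U)) ->
  measurable_fun [set: T] g.
Proof.
move=> gU; apply: (@measurability _ _ T (borel E) setT g (@open E)) => //.
by move=> _ [U oU <-]; rewrite setTI; exact: gU.
Qed.

Section aumann.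
Context d (T : measurableType d) (R : realType) (E : completeNormedModType R).
Hypothesis hE : separable_space E.
Variable N : set (set T).
Hypotheses (hull : has_hulls N) (NU : null_sigma_ideal N).

(** A point x of E is encoded by indices tau j of members of a dense sequence at
    distance at most 1/(j+1).  For a Suslin set G, membership of (w, x) in G then
    becomes a condition on w and on a sequence r coding both tau and the branch
    sig: F n (sig r) must meet each of the balls, and the centres must be
    compatible.  All these conditions are locally constant in r, so a branch of
    the scheme can be selected measurably in w, and its decoding is the
    selection. *)
Lemma aumann_selection (G : set (T * borel E)) : measurable G ->
  exists (D Z : set T) (g : T -> borel E),
    [/\ measurable D, N Z, measurable_fun setT g,
        forall w x, G (w, x) -> D w \/ Z w &
        forall w, D w -> G (w, g w)].
Proof.
move=> /measurable_suslin[A [F [mA cF lA lF GP]]].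
have [q qP] := separable_seq hE.
pose sig (r : nat -> nat) j := (natpair (r j)).1.
pose tau (r : nat -> nat) j := (natpair (r j)).2.
pose P i j r := (exists2 x, F i (sig r) x & `|x - q (tau r j)| <= j.+1%:R^-1) /\
  `|q (tau r i) - q (tau r j)| <= i.+1%:R^-1 + j.+1%:R^-1.
(* The index k codes the pair of indices (i, j) of the conditions. *)
pose C k r := A (natpair k).1 (sig r) `&`
  [set _ : T | P (natpair k).1 (natpair k).2 r].
have lsig X (f : (nat -> nat) -> X) :
    locally_constant f -> locally_constant (fun r => f (sig r)).
  exact: (locally_constant_reindex id (fun n => (natpair n).1)).
have ltau i : locally_constant (fun r => tau r i).
  exact: (locally_constant_reindex id (fun n => (natpair n).2)
    (@locally_constant_nth i)).
have mcst (Q : Prop) : measurable [set _ : T | Q].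
  have [q'|nq] := pselect Q.
    by rewrite (_ : [set _ | _] = setT)//; apply/seteqP; split.
  by rewrite (_ : [set _ | _] = set0)//; apply/seteqP; split.
have lC k : locally_constant (C k).
  rewrite /C; move: (natpair k) => [i j] /=.
  apply: (locally_constant_pair setI); first exact: lsig.
  apply: (@locally_constant_pair _ _ _ (fun (B : set E) (t : nat * nat) =>
    [set _ : T | (exists2 x, B x & `|x - q t.2| <= j.+1%:R^-1) /\
      `|q t.1 - q t.2| <= i.+1%:R^-1 + j.+1%:R^-1])
      (fun r => F i (sig r)) (fun r => (tau r i, tau r j))).
    exact: lsig.
  exact: (locally_constant_pair pair).
have mC k r : measurable (C k r) by apply: measurableI.
have [D [Z [b [mD NZ DZ bP mb]]]] := suslin_selection hull NU mC lC.
have gex w : exists x : E, D w -> forall m, `|x - q (tau (b w) m)| <= m.+1%:R^-1.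
  have [Dw|nDw] := pselect (D w); last by exists 0.
  have [|x xP] := @fast_cauchy_lim R E (fun m => q (tau (b w) m)).
    move=> i j; have [_ [_]] := bP w Dw (pickle (i, j)).
    by rewrite natpairK.
  by exists x.
have [g0 g0P] := choice gex.
pose g w := if w \in D then g0 w else 0.
have gP w : D w -> forall m, `|g w - q (tau (b w) m)| <= m.+1%:R^-1.
  by move=> Dw; rewrite /g mem_set//; exact: g0P.
exists D, Z, g; split => //.
- apply: measurable_fun_borel => U oU.
  rewrite (_ : g @^-1` U = (~` D `&` [set _ | U 0]) `|`
    (D `&` \bigcup_m \bigcup_k ([set w | b w m = k] `&`
      [set _ | forall x, `|x - q (natpair k).2| <= m.+1%:R^-1 -> U x]))).
    apply: measurableU; apply: measurableI => //; first exact: measurableC.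
    apply: bigcupT_measurable => m; apply: bigcupT_measurable => k.
    exact: measurableI.
  apply/seteqP; split=> [w Ugw|w [[nDw U0]|[Dw [m _ [k _ [bwm kU]]]]]] /=.
  + have [Dw|nDw] := pselect (D w); last first.
      by left; split=> //; move: Ugw; rewrite /g /= memNset.
    right; split => //.
    have /nbhs_ballP[e /= e0 eU] : nbhs (g w) U by exact: open_nbhs_nbhs.
    have [m mP] := natSinv_lt (divr_gt0 e0 (ltr0Sn R 1)).
    exists m => //; exists (b w m) => //; split => // x xm; apply: eU.
    rewrite -ball_normE /=; apply: le_lt_trans (ler_distD (q (tau (b w) m)) _ _) _.
    rewrite [ltRHS]splitr; apply: ltrD.
      by apply: le_lt_trans (gP _ Dw m) _; exact: mP.
    by rewrite distrC; apply: le_lt_trans xm _; exact: mP.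
  + by rewrite /g memNset.
  + by apply: kU; rewrite -bwm; exact: gP.
- move=> w x /GP[s /= sP].
  have /choice[t tP] : forall m, exists j, `|x - q j| < m.+1%:R^-1.
    by move=> m; apply: qP; rewrite invr_gt0 ltr0Sn.
  pose r m : nat := pickle (s m, t m).
  have sr : sig r = s by apply/funext => m; rewrite /sig natpairK.
  have tr : tau r = t by apply/funext => m; rewrite /tau natpairK.
  apply: (DZ r) => k; rewrite /C /P sr tr; case: (sP (natpair k).1) => As Fs.
  split => //=; split; first by exists x => //; exact/ltW/tP.
  apply: le_trans (ler_distD x _ _) _; apply: lerD; last exact/ltW/tP.
  by rewrite distrC; exact/ltW/tP.
- move=> w Dw; apply/GP; exists (sig (b w)) => n /=; split.
    by have [] := bP w Dw (pickle (n, 0%N)); rewrite natpairK.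
  apply: closed_approx => // e e0.
  have [m /(_ m (leqnn m)) mP] := natSinv_lt (divr_gt0 e0 (ltr0Sn R 1)).
  have [_] := bP w Dw (pickle (n, m)); rewrite natpairK /= => -[[x Fx xq] _].
  exists x => //; apply: le_lt_trans (ler_distD (q (tau (b w) m)) _ _) _.
  rewrite [ltRHS]splitr; apply: ltrD.
    exact: le_lt_trans (gP _ Dw m) mP.
  by rewrite distrC; exact: le_lt_trans xq mP.
Qed.

End aumann.

(** * Random sets over a sub-sigma-algebra *)

Section hulls.
Context d (Omega : measurableType d) (R : realType) (P : probability Omega R).
Variable H : set (set Omega).
Hypothesis hH : sub_sigma_algebra_of H.

Lemma sub_measurableE (A : set Omega) :
  measurable (A : set (g_sigma_algebraType H)) = H A.
Proof. by rewrite measurable_g_measurableTypeE//; case: hH. Qed.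

Lemma sub_measurable (A : set Omega) :
  measurable (A : set (g_sigma_algebraType H)) -> measurable A.
Proof. by rewrite sub_measurableE; case: hH => _; apply. Qed.

(** A hull in H is the intersection of a sequence of supersets in H whose
    probabilities approach the infimum. *)
Lemma sub_has_hulls :
  @has_hulls _ (g_sigma_algebraType H) (P.-negligible : set (set Omega)).
Proof.
move=> S.
pose V := [set P B | B in [set B : set (g_sigma_algebraType H) |
  measurable B /\ S `<=` B]].
have VT : V 1%E by exists setT => //; rewrite /= ?probability_setT.
have V0 : (0 <= ereal_inf V)%E.
  by apply/ereal_infP => _ [B _ <-]; exact: measure_ge0.
have Vfin : ereal_inf V \is a fin_num.
  by rewrite ge0_fin_numE//; apply: le_lt_trans (ltry 1); exact: ereal_inf_lbound.
have /choice[B BP] : forall n, exists B : set (g_sigma_algebraType H),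
    [/\ measurable B, S `<=` B & (P B < ereal_inf V + (n.+1%:R^-1)%:E)%E].
  move=> n; have n0 : 0 < (n.+1%:R^-1 : R) by rewrite invr_gt0 ltr0Sn.
  have [_ [B [mB SB] <-] BV] := lb_ereal_inf_adherent n0 Vfin.
  by exists B.
have mI : measurable (\bigcap_n B n : set (g_sigma_algebraType H)).
  by apply: bigcapT_measurable => n; case: (BP n).
exists (\bigcap_n B n); split => //.
  by move=> x Sx n _; case: (BP n) => _ + _; apply.
move=> B' mB' SB'; pose I := \bigcap_n B n.
have mI' := sub_measurable mI; have mB'' := sub_measurable mB'.
apply/negligibleP; first exact: measurableD.
rewrite measureD//; last by rewrite ltey_eq fin_num_measure.
apply/eqP; rewrite eq_le; apply/andP; split; last first.
  rewrite sube_ge0 ?fin_num_measure//; last exact: measurableI.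
  by apply: le_measure; rewrite ?inE//; exact: measurableI.
rewrite sube_le0; apply/lee_addgt0Pr => e e0.
have [n /(_ n (leqnn n)) ne] := natSinv_lt e0.
have [mBn SBn Bn] := BP n.
apply: (@le_trans _ _ (P (B n))).
  apply: le_measure; rewrite ?inE//; first exact: sub_measurable.
  exact: bigcap_inf.
apply: (le_trans (ltW Bn)); apply: leeD; last by rewrite lee_fin ltW.
apply: ereal_inf_lbound; exists (\bigcap_n B n `&` B') => //; split.
  exact: measurableI.
move=> x Sx; split; last exact: SB'.
by move=> k _; case: (BP k) => _ + _; apply.
Qed.

Lemma negligible_null_ideal :
  null_sigma_ideal (P.-negligible : set (set Omega)).
Proof. by move=> F NF; exact: negligible_bigcup. Qed.

End hulls.

Section selection.
Context (R : realType) (E : completeNormedModType R) (hE : separable_space E).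
Context d (Omega : measurableType d) (P : probability Omega R).

(** The sigma-algebra H may lack the null sets of P, so the domain of the selection
    covers the non-empty values of X only almost surely. *)
Lemma random_set_selection (H : set (set Omega)) (hH : sub_sigma_algebra_of H)
    (X : Omega -> set E) : random_set H X ->
  exists (D : set Omega) (g : Omega -> E),
    [/\ H D, random_vector H g, forall w, D w -> X w (g w) &
      {ae P, forall w, X w !=set0 -> D w}].
Proof.
move=> mX; have [D [Z [g [mD NZ mg XD Dg]]]] :=
  aumann_selection hE (@sub_has_hulls _ _ _ P H hH) (@negligible_null_ideal _ _ _ P) mX.
exists D, g; split => //; first by rewrite -(sub_measurableE hH).
apply: negligibleS NZ => w /= /not_implyP[[x Xx] nDw].
by case: (XD w x Xx).
Qed.

Lemma sub_sigma_algebra_self : sub_sigma_algebra_of (@measurable d Omega).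
Proof. by split => //; exact: sigma_algebra_measurable. Qed.

Hypothesis hP : measure_is_complete P.

Lemma ae_measurable (A : set Omega) : {ae P, forall w, A w} -> measurable A.
Proof.
move=> /hP mA; rewrite -(setCK A); exact: measurableC.
Qed.

(** Here completeness enters: for the full sigma-algebra the exceptional null set of
    the selection theorem is itself measurable. *)
Lemma measurable_projection (X : Omega -> set E) : random_set measurable X ->
  measurable [set w | X w !=set0].
Proof.
move=> mX; have [D [g [mD _ Dg XD]]] :=
  random_set_selection sub_sigma_algebra_self mX.
rewrite (_ : [set w | X w !=set0] =
  D `|` ~` [set w | X w !=set0 -> D w]).
  by apply: measurableU => //; exact/measurableC/ae_measurable.
apply/seteqP; split=> w /=; last by case=> [/Dg ?|/not_implyP[]//]; exists (g w).
move=> Xw; have [Dw|nDw] := pselect (D w); first by left.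
by right => /(_ Xw).
Qed.

End selection.

Section caratheodory.
Context (R : realType) (E : completeNormedModType R) (hE : separable_space E).

(** With q dense, f w x > c holds iff for some m the value f w (q j) exceeds
    c + 1/(m+1) at every q j at distance less than 1/(m+1) of x. *)
Lemma measurable_caratheodory d (T : measurableType d) (f : T -> E -> R) :
  (forall x, measurable_fun [set: T] (f^~ x)) ->
  (forall w, continuous (f w)) ->
  measurable_fun [set: T * borel E] (fun p => f p.1 p.2).
Proof.
move=> mf cf; have [q qP] := separable_seq hE.
apply: (measurability _ (RGenOInfty.measurableE R)) => _ [_ [c ->] <-].
rewrite setTI.
pose far j m := [set x | m.+1%:R^-1 <= `|x - q j|].
have cfar j m : closed (far j m).
  apply: (@preimage_closed _ _ (fun x => `|x - q j|) [set t | m.+1%:R^-1 <= t]).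
    by move=> x _; apply: cvg_norm; apply: cvgB; [exact: cvg_id|exact: cvg_cst].
  exact: closed_ge.
rewrite (_ : _ @^-1` _ = \bigcup_m \bigcap_j
  (([set: T] `*` (far j m : set (borel E))) `|`
   ([set w | c + m.+1%:R^-1 < f w (q j)] `*` [set: borel E]))).
  apply: bigcupT_measurable => m; apply: bigcapT_measurable => j.
  apply: measurableU; apply: measurableX => //.
    rewrite -(setCK (far j m)); apply: measurableC.
    by apply: sub_sigma_algebra; exact: closed_openC.
  have := mf (q j) measurableT `]c + m.+1%:R^-1, +oo[%classic (measurable_itv _).
  rewrite setTI; congr measurable; apply/seteqP; split=> w /=;
    by rewrite in_itv /= andbT.
apply/seteqP; split=> [[w x]|[w x] [m _ fP]] /=; rewrite in_itv /= andbT.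
  move=> cfx; pose e := (f w x - c) / 2.
  have e0 : 0 < e by rewrite divr_gt0// subr_gt0.
  have /cvgrPdist_lt/(_ e e0) := cf w x.
  move=> /nbhs_ballP[r /= r0 rP].
  have [m1 m1P] := natSinv_lt r0; have [m2 m2P] := natSinv_lt e0.
  pose m := maxn m1 m2.
  exists m => // j _; have [?|xq] := leP m.+1%:R^-1 `|x - q j|; first by left.
  right; split => //=.
  have /rP : ball x r (q j).
    by rewrite -ball_normE /=; apply: lt_trans xq _; exact: m1P (leq_maxl _ _).
  rewrite ltr_norml => /andP[_]; have := m2P m (leq_maxr _ _).
  by rewrite /e; move: (m.+1%:R^-1) => a; lra.
suff : c + m.+1%:R^-1 <= f w x.
  by apply: lt_le_trans; rewrite ltrDl invr_gt0 ltr0Sn.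
apply/ler_addgt0Pr => e e0.
have /cvgrPdist_lt/(_ e e0)/nbhs_ballP[r /= r0 rP] := cf w x.
have [j xj] : exists j, `|x - q j| < Num.min r m.+1%:R^-1.
  by apply: qP; rewrite lt_min r0 invr_gt0 ltr0Sn.
move: xj; rewrite lt_min => /andP[xr xm].
have [[_ /=]|[/= cf' _]] := fP j I; first by rewrite /far /= leNgt xm.
have /rP : ball x r (q j) by rewrite -ball_normE.
rewrite ltr_norml => /andP[/ltW + _]; rewrite lerBrDl => h.
apply: le_trans (ltW cf') _.
by rewrite -lerBlDr (le_trans _ h)//  lerBlDr.
Qed.

Lemma measurable_dual_eval d (Omega : measurableType d) (G : set (set Omega))
    (zeta : Omega -> dual E) : L0_dual G zeta ->
  measurable_fun [set: g_sigma_algebraType G * borel E]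
    (fun p => zeta p.1 p.2 : R).
Proof.
move=> mz; apply: (@measurable_caratheodory _ (g_sigma_algebraType G)
  (fun w x => zeta w x)) => // w.
exact: dual_continuous.
Qed.

End caratheodory.

(** * Selections and conditional essential infima *)

Lemma measurable_fun_in d d' (T : measurableType d) (T' : measurableType d')
    (D : set T) (f g : T -> T') :
  measurable D -> measurable_fun [set: T] f -> measurable_fun [set: T] g ->
  measurable_fun [set: T] (fun w => if w \in D then f w else g w).
Proof.
move=> mD mf mg; apply: measurable_fun_ifT => //.
apply: (measurable_fun_bool true).
rewrite setTI (_ : _ @^-1` _ = D)//.
by apply/seteqP; split=> w; [move/set_mem|move/mem_set].
Qed.

Section conditional.
Context (R : realType) (E : completeNormedModType R) (hE : separable_space E).
Context d (Omega : measurableType d) (P : probability Omega R).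
Context (H : set (set Omega)) (hH : sub_sigma_algebra_of H).

(** Maximality of the essential infimum applied to the function equal to f on D and
    to -oo elsewhere. *)
Lemma cond_essinf_local (eta e f : Omega -> \bar R) (D : set Omega) :
  is_cond_essinf P H eta e -> H D ->
  measurable_fun [set: g_sigma_algebraType H]
    (f : g_sigma_algebraType H -> \bar R) ->
  {ae P, forall w, D w -> (f w <= eta w)%E} ->
  {ae P, forall w, D w -> (f w <= e w)%E}.
Proof.
move=> [_ _ emax] HD mf fD.
have /emax : measurable_fun [set: g_sigma_algebraType H]
    ((fun w => if w \in D then f w else -oo%E) : g_sigma_algebraType H -> \bar R).
  by apply: measurable_fun_in => //; rewrite (sub_measurableE hH).
have : {ae P, forall w, ((if w \in D then f w else -oo) <= eta w)%E}.
  apply: filterS fD => w fD; case: ifPn => [|_]; last by rewrite leNye.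
  by rewrite inE.
move=> /[swap] /[apply]; apply: filterS => w + Dw.
by rewrite mem_set.
Qed.

(** The way in which selections are used: an exceptional set with an H-measurable
    graph is negligible as soon as it has no selection over a non-negligible
    event of H. *)
Lemma ae_random_set_empty (B : Omega -> set E) : random_set H B ->
  (forall D g, H D -> random_vector H g -> (forall w, D w -> B w (g w)) ->
    {ae P, forall w, ~ D w}) ->
  {ae P, forall w, B w = set0}.
Proof.
move=> mB Bsel; have [D [g [HD mg Dg BD]]] := random_set_selection hE P hH mB.
apply: filterS2 BD (Bsel D g HD mg Dg) => w BD nD.
by apply/seteqP; split => // x Bx; apply: nD; apply: BD; exists x.
Qed.

Lemma measurable_fun_graph (g : Omega -> E) : random_vector H g ->
  measurable_fun [set: g_sigma_algebraType H]
    ((fun w => (w, g w)) : g_sigma_algebraType H -> g_sigma_algebraType H * borel E).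
Proof.
by move=> mg; apply/measurable_fun_pairP; split; [exact: measurable_id|exact: mg].
Qed.

Lemma measurable_fun_fst_comp (e : Omega -> \bar R) :
  measurable_fun [set: g_sigma_algebraType H]
    (e : g_sigma_algebraType H -> \bar R) ->
  measurable_fun [set: g_sigma_algebraType H * borel E] (fun p => e p.1).
Proof. by move=> me; apply: (measurableT_comp me); exact: measurable_fst. Qed.

(** For each ball of a countable base, select from the part of M in that ball.  Almost
    surely, a point of M w is then a limit of values of these selections, which
    belong to the closed set X w. *)
Lemma random_set_subset_closed (X M : Omega -> set E) : random_set H M ->
  {ae P, forall w, closed (X w)} ->
  (forall D g, H D -> random_vector H g -> (forall w, D w -> M w (g w)) ->
    {ae P, forall w, D w -> X w (g w)}) ->
  {ae P, forall w, M w `<=` X w}.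
Proof.
move=> mM cX selX; have [q qP] := separable_seq hE.
pose B k w := M w `&` [set x | `|x - q (natpair k).1| < (natpair k).2.+1%:R^-1].
have /choice[D /choice[g Dg]] : forall k, exists D g,
    [/\ H D, random_vector H g, forall w, D w -> B k w (g w) &
      {ae P, forall w, B k w !=set0 -> D w}].
  move=> k; apply: random_set_selection => //.
  pose U : set (borel E) := [set x | `|x - q (natpair k).1| < (natpair k).2.+1%:R^-1].
  rewrite /random_set (_ : [set p | B k p.1 p.2] =
    [set p | M p.1 p.2] `&` ([set: g_sigma_algebraType H] `*` U)).
    apply: measurableI => //; apply: measurableX => //; apply: sub_sigma_algebra.
    rewrite (_ : U = ball (q (natpair k).1) (natpair k).2.+1%:R^-1).
      by apply: ball_open; rewrite invr_gt0 ltr0Sn.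
    by rewrite -ball_normE; apply/seteqP; split=> x /=; rewrite /U /= distrC.
  by apply/seteqP; split=> [p []|p [? []]].
have BD : {ae P, forall w, forall k, B k w !=set0 -> D k w}.
  by apply: ae_foralln => k; case: (Dg k).
have DX : {ae P, forall w, forall k, D k w -> X w (g k w)}.
  apply: ae_foralln => k; case: (Dg k) => HD mg DB _.
  by apply: selX => // w /DB[].
apply: filterS3 cX BD DX => w cX BD DX x Mx; apply: closed_approx => // e e0.
have [m /(_ m (leqnn m)) mP] := natSinv_lt (divr_gt0 e0 (ltr0Sn R 1)).
have [j xj] := qP x m.+1%:R^-1 (eqbRL (invr_gt0 _) (ltr0Sn R m)).
pose k : nat := pickle (j, m).
have /BD Dk : B k w !=set0 by exists x; rewrite /B /k natpairK.
exists (g k w); first exact: DX.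
have [_ _ /(_ w Dk)[_ +] _] := Dg k; rewrite /= /k natpairK /= => gq.
apply: le_lt_trans (ler_distD (q j) _ _) _; rewrite [ltRHS]splitr.
apply: ltrD; first exact: lt_trans xj mP.
by rewrite distrC; exact: lt_trans gq mP.
Qed.

Variables (X M : Omega -> set E).

Section core_upper_bounds.
Hypotheses (mM : random_set H M) (MX : {ae P, forall w, M w `<=` X w}).

Lemma support_subset_essinf (zeta : Omega -> dual E) (e : Omega -> \bar R) :
  L0_dual H zeta ->
  is_cond_essinf P H (fun w => support (X w) (zeta w)) e ->
  {ae P, forall w, (support (M w) (zeta w) <= e w)%E}.
Proof.
move=> mz he; have me : measurable_fun [set: g_sigma_algebraType H]
  (e : g_sigma_algebraType H -> \bar R) by case: he.
have mzE : measurable_fun [set: g_sigma_algebraType H * borel E]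
    (fun p => (zeta p.1 p.2)%:E).
  by apply/measurable_EFinP; exact: measurable_dual_eval.
pose B w := [set x | M w x /\ (e w < (zeta w x)%:E)%E].
have mB : random_set H B.
  apply: measurableI => //; rewrite -[X in measurable X]setTI.
  by apply: measurable_lte => //; exact: measurable_fun_fst_comp.
suff : {ae P, forall w, B w = set0}.
  apply: filterS => w B0; apply: ge_ereal_sup => _ [x Mx <-].
  by rewrite leNgt; apply/negP => ez; have : B w x by []; rewrite B0.
apply: ae_random_set_empty => // D g HD mg BD.
have mf : measurable_fun [set: g_sigma_algebraType H]
    ((fun w => (zeta w (g w))%:E) : g_sigma_algebraType H -> \bar R).
  exact: (measurableT_comp mzE (measurable_fun_graph mg)).
have fD : {ae P, forall w, D w ->
    ((zeta w (g w))%:E <= support (X w) (zeta w))%E}.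
  apply: filterS MX => w MXw /BD[Mg _]; apply: ereal_sup_ubound.
  by exists (g w) => //; exact: MXw.
apply: filterS (cond_essinf_local he HD mf fD) => w fe Dw.
by have [_] := BD w Dw; rewrite ltNge fe.
Qed.

Lemma subset_essinf_field (zeta : Omega -> dual E) (phi : Omega -> E -> \bar R) :
  is_cond_essinf_field P H
    (fun w x => support (X w) (zeta w) - (zeta w x)%:E)%E phi ->
  {ae P, forall w, M w `<=` [set x | (0 <= phi w x)%E]}.
Proof.
move=> [mphi hphi].
pose B w := [set x | M w x /\ (phi w x < 0)%E].
have mB : random_set H B.
  apply: measurableI => //; rewrite -[X in measurable X]setTI.
  exact: measurable_lte.
suff : {ae P, forall w, B w = set0}.
  apply: filterS => w B0 x Mx /=.
  by rewrite leNgt; apply/negP => ez; have : B w x by []; rewrite B0.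
apply: ae_random_set_empty => // D g HD mg BD.
have fD : {ae P, forall w, D w ->
    (0 <= support (X w) (zeta w) - (zeta w (g w))%:E)%E}.
  apply: filterS MX => w MXw /BD[Mg _]; rewrite sube_ge0//.
  by apply: ereal_sup_ubound; exists (g w) => //; exact: MXw.
apply: filterS (cond_essinf_local (hphi g mg) HD (measurable_cst _) fD) => w fe Dw.
by have [_] := BD w Dw; rewrite ltNge fe.
Qed.

End core_upper_bounds.

Hypothesis hM : is_cond_core P H X M.

Lemma core_contains (M' : Omega -> set E) : random_set H M' ->
  {ae P, forall w, closed (X w)} ->
  (forall D g, H D -> random_vector H g -> (forall w, D w -> M' w (g w)) ->
    {ae P, forall w, D w -> X w (g w)}) ->
  {ae P, forall w, M' w `<=` M w}.
Proof.
move=> mM' cX selX; case: hM => _ _; apply => //.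
exact: random_set_subset_closed.
Qed.

End conditional.

Section halfspaces.
Context (R : realType) (E : completeNormedModType R) (hE : separable_space E).
Context d (Omega : measurableType d) (P : probability Omega R).
Context (H : set (set Omega)) (hH : sub_sigma_algebra_of H).
Variables (X M : Omega -> set E).
Hypotheses (hM : is_cond_core P H X M) (cX : {ae P, forall w, closed (X w)}).

(** One inclusion holds field by field.  For the other, a selection g of the
    intersection satisfies 0 <= phi n g <= h_X(zeta_n) - <zeta_n, g> almost surely
    for all n, so that it lies in all the half-spaces, that is, in X. *)
Lemma core_eq_bigcap_fields (zeta : nat -> Omega -> dual E)
    (phi : nat -> Omega -> E -> \bar R) :
  {ae P, forall w, X w = \bigcap_n
    [set x | ((zeta n w x)%:E <= support (X w) (zeta n w))%E]} ->
  (forall n, is_cond_essinf_field P H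
    (fun w x => support (X w) (zeta n w) - (zeta n w x)%:E)%E (phi n)) ->
  {ae P, forall w, M w = \bigcap_n [set x | (0 <= phi n w x)%E]}.
Proof.
move=> XE hphi; have [mM MX _] := hM.
have sub n : {ae P, forall w, M w `<=` [set x | (0 <= phi n w x)%E]}.
  exact: (subset_essinf_field hE hH mM MX (hphi n)).
have sup : {ae P, forall w, \bigcap_n [set x | (0 <= phi n w x)%E] `<=` M w}.
  apply: (core_contains hE hH hM) => //.
    rewrite /random_set (_ : [set p | _] = \bigcap_n
      [set p : g_sigma_algebraType H * borel E | (0 <= phi n p.1 p.2)%E]).
      apply: bigcapT_measurable => n; rewrite -[X in measurable X]setTI.
      by case: (hphi n) => mphi _; exact: measurable_lee.
    by apply/seteqP; split.
  move=> D g HD mg Dg.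
  have ge n : {ae P, forall w, (phi n w (g w) <=
      support (X w) (zeta n w) - (zeta n w (g w))%:E)%E}.
    by case: (hphi n) => _ /(_ g mg)[].
  apply: filterS2 XE (ae_foralln ge) => w XEw gew Dw.
  rewrite XEw => n _ /=.
  rewrite -sube_ge0//; apply: le_trans (gew n); exact: Dg.
apply: filterS2 (ae_foralln sub) sup => w {}sub {}sup.
by apply/seteqP; split => // x Mx n _; exact: sub.
Qed.

End halfspaces.

(** * Linear minorants of sublinear functionals *)

Lemma continuous_linear_dual (R : realType) (E : normedModType R) (L : E -> R^o) :
  linear L -> continuous L -> exists u : dual E, forall x, u x = L x.
Proof.
move=> linL cL.
pose LL : {linear E -> R^o} := HB.pack L (GRing.isLinear.Build R E R^o *:%R L linL).
by exists (@Dual _ _ LL cL).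
Qed.

Section sublinear.
Context (R : realType) (E : normedModType R).
Implicit Types (p : E -> R) (x y z : E).

Definition sublinear p :=
  (forall x y, p (x + y) <= p x + p y) /\
  (forall t x, 0 <= t -> p (t *: x) = t * p x).

Lemma sublinear0 p : sublinear p -> p 0 = 0.
Proof. by case=> _ /(_ 0 0 (lexx 0)); rewrite scale0r mul0r. Qed.

Lemma sublinear_oppr_le p x : sublinear p -> - p (- x) <= p x.
Proof.
move=> sp; have := sublinear0 sp; case: sp => /(_ x (- x)) + _ p0.
by rewrite subrr p0 -lerBlDr sub0r.
Qed.

(** The directional derivative at infinity of p along z.  The difference
    p (x + t z) - t p z is nonincreasing in t, so that integers t suffice, which
    keeps the infimum countable. *)
Definition tilt p z x := inf [set p (x + n%:R *: z) - n%:R * p z | n in [set: nat]].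

Lemma tilt_bound p z x t : sublinear p -> 0 <= t ->
  - p (- x) <= p (x + t *: z) - t * p z.
Proof.
move=> [pD pZ] t0; rewrite lerBrDr addrC lerBlDr -pZ//.
by apply: le_trans (pD _ _); rewrite addrAC subrr add0r.
Qed.

Lemma tilt_has_lbound p z x : sublinear p ->
  has_lbound [set p (x + n%:R *: z) - n%:R * p z | n in [set: nat]].
Proof. by move=> sp; exists (- p (- x)) => _ [n _ <-]; exact: tilt_bound. Qed.

Lemma tilt_le p z x t : sublinear p -> 0 <= t ->
  tilt p z x <= p (x + t *: z) - t * p z.
Proof.
move=> sp t0; pose n := (Num.trunc t).+1.
have tn : 0 <= n%:R - t by rewrite subr_ge0 ltW// truncnS_gt.
apply: (@le_trans _ _ (p (x + n%:R *: z) - n%:R * p z)).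
  by apply: ge_inf; [exact: tilt_has_lbound|exists n].
have -> : x + n%:R *: z = (x + t *: z) + (n%:R - t) *: z.
  by rewrite scalerBl addrACA subrr addr0.
case: sp => pD pZ; have := pD (x + t *: z) ((n%:R - t) *: z).
rewrite (pZ _ _ tn); lra.
Qed.

Lemma le_tilt p z x c : (forall t, 0 <= t -> c <= p (x + t *: z) - t * p z) ->
  c <= tilt p z x.
Proof.
move=> cP; apply: lb_le_inf; first by exists (p (x + 0 *: z) - 0 * p z), 0%N.
by move=> _ [n _ <-]; exact: cP.
Qed.

Lemma tilt_le_self p z x : sublinear p -> tilt p z x <= p x.
Proof.
by move=> sp; apply: le_trans (tilt_le z x sp (lexx 0)) _;
  rewrite scale0r addr0 mul0r subr0.
Qed.

Lemma sublinear_tilt p z : sublinear p -> sublinear (tilt p z).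
Proof.
move=> sp; have [pD pZ] := sp.
have tiltZ s x : 0 < s -> s * tilt p z x <= tilt p z (s *: x).
  move=> s0; apply: le_tilt => t t0; have s0' := lt0r_neq0 s0.
  rewrite -ler_pdivlMl//.
  apply: le_trans (tilt_le z x sp (divr_ge0 t0 (ltW s0))) _.
  rewrite le_eqVlt; apply/orP; left; apply/eqP.
  rewrite (_ : s *: x + t *: z = s *: (x + (t / s) *: z)) ?pZ ?(ltW s0)//.
    by field.
  by rewrite scalerDr scalerA mulrCA divff// mulr1.
split=> [x y|s x].
  rewrite -lerBlDr; apply: le_tilt => t t0.
  rewrite lerBlDr -lerBlDl; apply: le_tilt => u u0.
  rewrite lerBlDl; apply: le_trans (tilt_le z _ sp (addr_ge0 t0 u0)) _.
  have -> : x + y + (t + u) *: z = (x + t *: z) + (y + u *: z).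
    by rewrite scalerDl addrACA.
  by have := pD (x + t *: z) (y + u *: z); lra.
rewrite le_eqVlt => /orP[/eqP <-|s0]; last first.
  apply/eqP; rewrite eq_le tiltZ// andbT -ler_pdivrMl//.
  apply: le_trans (tiltZ _ _ _) _; first by rewrite invr_gt0.
  by rewrite scalerA mulVf ?scale1r// gt_eqF.
rewrite scale0r mul0r; apply/eqP; rewrite eq_le; apply/andP; split.
  by apply: le_trans (tilt_le_self z 0 sp) _; rewrite sublinear0.
apply: le_tilt => t t0; have := tilt_bound z 0 sp t0.
by rewrite oppr0 sublinear0// oppr0.
Qed.

(** The point of tilting: the new functional is linear along z. *)
Lemma tilt_flat p z : sublinear p -> tilt p z z + tilt p z (- z) <= 0.
Proof.
move=> sp; have := tilt_le_self z z sp.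
have := tilt_le z (- z) sp ler01.
rewrite scale1r addNr sublinear0// mul1r.
by lra.
Qed.

Definition tilts p (q : nat -> E) := fix tilts n :=
  if n is m.+1 then tilt (tilts m) (q m) else p.

Lemma sublinear_tilts p q n : sublinear p -> sublinear (tilts p q n).
Proof. by move=> sp; elim: n => //= n IHn; exact: sublinear_tilt. Qed.

Lemma tilts_le p q m n x : sublinear p -> (m <= n)%N ->
  tilts p q n x <= tilts p q m x.
Proof.
move=> sp; elim: n => [|n IHn]; first by rewrite leqn0 => /eqP ->.
rewrite leq_eqVlt => /orP[/eqP -> //|]; rewrite ltnS => /IHn; apply: le_trans.
exact/tilt_le_self/sublinear_tilts.
Qed.

(** The limit of the successive tilts along the sequence q, which decrease. *)
Definition flat_minorant p q x := inf [set tilts p q n x | n in [set: nat]].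

Variables (p : E -> R) (q : nat -> E).
Hypotheses (sp : sublinear p) (p_norm : forall x, p x <= `|x|).
Hypothesis qP : forall x (e : R), 0 < e -> exists j, `|x - q j| < e.

Lemma flat_minorant_has_lbound x : has_lbound [set tilts p q n x | n in [set: nat]].
Proof.
exists (- p (- x)) => _ [n _ <-].
apply: le_trans (sublinear_oppr_le _ (sublinear_tilts q n sp)).
by rewrite lerN2; exact: (@tilts_le p q 0 n).
Qed.

Lemma flat_minorant_le n x : flat_minorant p q x <= tilts p q n x.
Proof. by apply: ge_inf; [exact: flat_minorant_has_lbound|exists n]. Qed.

Lemma le_flat_minorant c x : (forall n, c <= tilts p q n x) ->
  c <= flat_minorant p q x.
Proof.
move=> cP; apply: lb_le_inf; first by exists (tilts p q 0 x), 0%N.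
by move=> _ [n _ <-].
Qed.

Lemma sublinear_flat_minorant : sublinear (flat_minorant p q).
Proof.
have L n : sublinear (tilts p q n) by exact: sublinear_tilts.
have LZ s x : 0 < s -> s * flat_minorant p q x <= flat_minorant p q (s *: x).
  move=> s0; apply: le_flat_minorant => n.
  by rewrite (L n).2 ?(ltW s0)// ler_pM2l// flat_minorant_le.
split=> [x y|s x].
  rewrite -lerBlDr; apply: le_flat_minorant => n.
  rewrite lerBlDr -lerBlDl; apply: le_flat_minorant => m.
  rewrite lerBlDl; apply: le_trans (flat_minorant_le (maxn n m) _) _.
  apply: le_trans ((L _).1 _ _) _; apply: lerD.
    by apply: tilts_le => //; rewrite leq_maxl.
  by apply: tilts_le => //; rewrite leq_maxr.
rewrite le_eqVlt => /orP[/eqP <-|s0]; last first.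
  apply/eqP; rewrite eq_le LZ// andbT -ler_pdivrMl//.
  apply: le_trans (LZ _ _ _) _; first by rewrite invr_gt0.
  by rewrite scalerA mulVf ?scale1r// gt_eqF.
rewrite scale0r mul0r; apply/eqP; rewrite eq_le; apply/andP; split.
  by apply: le_trans (flat_minorant_le 0 _) _; rewrite sublinear0.
by apply: le_flat_minorant => n; rewrite sublinear0.
Qed.

Lemma flat_minorant_norm x : flat_minorant p q x <= `|x|.
Proof. exact: le_trans (flat_minorant_le 0 x) (p_norm x). Qed.

(** Each q j is a direction along which the functional is linear; the bound by the
    norm makes it 1-Lipschitz, and oddness passes to all x by density. *)
Lemma flat_minorantN x : flat_minorant p q (- x) = - flat_minorant p q x.
Proof.
have sL := sublinear_flat_minorant; set L := flat_minorant p q in sL *.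
apply/eqP; rewrite eq_le; apply/andP; split; last first.
  by rewrite -[in leLHS](opprK x); exact: sublinear_oppr_le.
suff small (e : R) : 0 < e -> L (- x) + L x <= e.
  by rewrite -subr_le0 opprK; apply/ler_addgt0Pr => e /small; rewrite add0r.
move=> e0.
have [j xj] := qP x (divr_gt0 e0 (ltr0Sn R 1)).
have flat : L (q j) + L (- q j) <= 0.
  apply: le_trans (tilt_flat (q j) (sublinear_tilts q j sp)).
  by apply: lerD; exact: (flat_minorant_le j.+1).
have h1 : L x <= L (q j) + `|x - q j|.
  apply: (@le_trans _ _ (L (q j) + L (x - q j))); last by rewrite lerD2l flat_minorant_norm.
  by apply: le_trans (sL.1 _ _); rewrite addrC subrK.
have h2 : L (- x) <= L (- q j) + `|x - q j|.
  apply: (@le_trans _ _ (L (- q j) + L (q j - x))).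
    by apply: le_trans (sL.1 _ _); rewrite addKr.
  by rewrite lerD2l distrC flat_minorant_norm.
by move: flat h1 h2 xj; lra.
Qed.

Lemma flat_minorant_dual : exists u : dual E, forall x, u x = flat_minorant p q x.
Proof.
have sL := sublinear_flat_minorant; have LN := flat_minorantN.
set L := flat_minorant p q in sL LN *.
have LD x y : L (x + y) = L x + L y.
  apply/eqP; rewrite eq_le sL.1/= -lerN2 opprD -!LN opprD; exact: sL.1.
have LZ t x : L (t *: x) = t * L x.
  have [t0|t0] := leP 0 t; first exact: sL.2.
  by rewrite -[t]opprK scaleNr LN sL.2 ?mulNr// oppr_ge0 ltW.
apply: (@continuous_linear_dual _ _ (L : E -> R^o)) => [t x y|x].
  by rewrite LD LZ.
apply/cvgrPdist_lt => e e0; near=> y.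
apply: (@le_lt_trans _ _ `|x - y|); last by near: y; exact: cvgr_dist_lt.
rewrite -LN -LD ler_norml flat_minorant_norm andbT lerNl -LN.
by rewrite -(normrN (x - y)) flat_minorant_norm.
Unshelve. all: by end_near. Qed.

End sublinear.

(** * Measurable dependence on a parameter and cone gauges *)

Section measurable_hahn_banach.
Context d (T : measurableType d) (R : realType).

Lemma measurable_fun_inf (h : nat -> T -> R) :
  (forall w, has_lbound [set h n w | n in [set: nat]]) ->
  (forall n, measurable_fun [set: T] (h n)) ->
  measurable_fun [set: T] (fun w => inf [set h n w | n in [set: nat]]).
Proof.
move=> lh mh.
rewrite (_ : (fun w => _) = (fun w => infs (h^~ w) 0)).
  by apply: measurable_fun_infs => // w _; exact: lh.
apply/funext => w; rewrite /infs /sdrop; congr inf.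
by apply/seteqP; split=> _ [n _ <-]; exists n.
Qed.

Variables (E : normedModType R) (p : T -> E -> R) (q : nat -> E).
Hypotheses (sp : forall w, sublinear (p w)) (p_norm : forall w x, p w x <= `|x|).
Hypothesis qP : forall x (e : R), 0 < e -> exists j, `|x - q j| < e.
Hypothesis mp : forall x, measurable_fun [set: T] (p^~ x).

Lemma measurable_tilts n x : measurable_fun [set: T] (fun w => tilts (p w) q n x).
Proof.
elim: n x => //= n IHn x; apply: measurable_fun_inf => [w|m].
  exact/tilt_has_lbound/sublinear_tilts.
by apply: measurable_funB => //; apply: measurable_funM => //; exact: measurable_cst.
Qed.

(** The linear minorant is obtained by countably many infima from the values of p,
    hence is measurable in the parameter. *)
Lemma measurable_hahn_banach : exists zeta : T -> dual E,
  (forall x, measurable_fun [set: T] (fun w => zeta w x : R)) /\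
  forall w x, zeta w x <= p w x.
Proof.
have /choice[zeta zetaE] : forall w, exists u : dual E,
    forall x, u x = flat_minorant (p w) q x.
  by move=> w; exact: flat_minorant_dual.
exists zeta; split=> [x|w x]; last first.
  by rewrite zetaE; exact: (flat_minorant_le q (sp w) 0).
rewrite (_ : (fun w => _) = (fun w => flat_minorant (p w) q x)); last first.
  by apply/funext => w; rewrite zetaE.
apply: measurable_fun_inf => [w|n]; first exact: flat_minorant_has_lbound.
exact: measurable_tilts.
Qed.

End measurable_hahn_banach.

Section cone_gauge.
Context (R : realType) (E : normedModType R).
Variables (K : set E) (q : E) (r : R).
Implicit Types x y k : E.

Definition cone_gauge_set x :=
  [set v | exists t k, [/\ 0 <= t, K k & v = `|x - t *: (k - q)| - t * r]].

(** The largest sublinear functional below the norm that is at most - r on K - q: a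
    linear minorant of it is a functional of norm at most 1 separating q from K by
    the margin r. *)
Definition cone_gauge x := inf (cone_gauge_set x).

Hypotheses (K0 : K !=set0) (r0 : 0 <= r) (Kr : forall k, K k -> r <= `|k - q|).
Hypothesis Kcvx : convex_set K.

Lemma convex_setP (a b : R) x y : 0 <= a -> 0 <= b -> a + b = 1 -> K x -> K y ->
  K (a *: x + b *: y).
Proof.
move=> a0 b0 ab Kx Ky; have a1 : a <= 1 by rewrite -ab lerDl.
have := Kcvx (Itv01 a0 a1) (mem_set Kx) (mem_set Ky).
by move/set_mem; rewrite /conv /= /unstable.onem -ab [a + b]addrC addrK.
Qed.

Lemma cone_gauge_has_lbound x : has_lbound (cone_gauge_set x).
Proof.
exists (- `|x|) => _ [t [k [t0 Kk ->]]].
rewrite lerBrDr addrC lerBlDr.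
apply: (@le_trans _ _ `|t *: (k - q)|).
  by rewrite normrZ ger0_norm// ler_wpM2l// Kr.
by rewrite -{1}(subKr x (t *: (k - q))) (le_trans (ler_normB _ _))// addrC.
Qed.

Lemma cone_gauge_set_neq0 x : cone_gauge_set x !=set0.
Proof.
by case: K0 => k Kk; exists (`|x - 0 *: (k - q)| - 0 * r), 0, k; split.
Qed.

Lemma cone_gauge_le x t k : 0 <= t -> K k ->
  cone_gauge x <= `|x - t *: (k - q)| - t * r.
Proof. by move=> t0 Kk; apply: ge_inf; [exact: cone_gauge_has_lbound|exists t, k]. Qed.

Lemma le_cone_gauge x c :
  (forall t k, 0 <= t -> K k -> c <= `|x - t *: (k - q)| - t * r) ->
  c <= cone_gauge x.
Proof.
move=> cP; apply: lb_le_inf; first exact: cone_gauge_set_neq0.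
by move=> _ [t [k [t0 Kk ->]]]; exact: cP.
Qed.

Lemma cone_gauge_norm x : cone_gauge x <= `|x|.
Proof.
case: K0 => k Kk; apply: le_trans (cone_gauge_le x (lexx 0) Kk) _.
by rewrite scale0r subr0 mul0r subr0.
Qed.

Lemma sublinear_cone_gauge : sublinear cone_gauge.
Proof.
have gZ s x : 0 < s -> s * cone_gauge x <= cone_gauge (s *: x).
  move=> s0; apply: le_cone_gauge => t k t0 Kk; have s_neq0 := lt0r_neq0 s0.
  apply: (@le_trans _ _ (s * (`|x - (t / s) *: (k - q)| - t / s * r))).
    by rewrite ler_pM2l// cone_gauge_le// divr_ge0// ltW.
  rewrite mulrBr mulrA -{1}(ger0_norm (ltW s0)) -normrZ scalerBr scalerA.
  by rewrite [s * (t / s)]mulrCA divff// mulr1.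
split=> [x y|s x].
  rewrite -lerBlDr; apply: le_cone_gauge => t k t0 Kk.
  rewrite lerBlDr -lerBlDl; apply: le_cone_gauge => u l u0 Kl; rewrite lerBlDl.
  have [tu|tu] := eqVneq (t + u) 0.
    have [-> ->] : t = 0 /\ u = 0 by split; apply/eqP; rewrite eq_le; apply/andP; split => //; rewrite -tu ?lerDl ?lerDr.
    rewrite !scale0r !mul0r !subr0.
    exact: le_trans (cone_gauge_norm _) (ler_normD _ _).
  have tu0 : 0 < t + u by rewrite lt0r tu addr_ge0.
  have Km : K ((t / (t + u)) *: k + (u / (t + u)) *: l).
    by apply: convex_setP => //; rewrite ?divr_ge0 ?(ltW tu0)// -mulrDl divff.
  apply: le_trans (cone_gauge_le _ (ltW tu0) Km) _.
  rewrite (_ : x + y - _ = (x - t *: (k - q)) + (y - u *: (l - q))).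
    have := ler_normD (x - t *: (k - q)) (y - u *: (l - q)); lra.
  rewrite addrACA -opprD; congr (_ - _); rewrite !scalerBr !scalerDr !scalerA.
  rewrite !mulrA ![(t + u) * _]mulrC -!mulrA divff// !mulr1.
  by rewrite scalerDl opprD addrACA.
rewrite le_eqVlt => /orP[/eqP <-|s0]; last first.
  apply/eqP; rewrite eq_le gZ// andbT -ler_pdivrMl//.
  apply: le_trans (gZ _ _ _) _; first by rewrite invr_gt0.
  by rewrite scalerA mulVf ?scale1r// gt_eqF.
rewrite scale0r mul0r; apply/eqP; rewrite eq_le; apply/andP; split.
  by apply: le_trans (cone_gauge_norm _) _; rewrite normr0.
apply: le_cone_gauge => t k t0 Kk.
by rewrite sub0r normrN normrZ ger0_norm// subr_ge0 ler_wpM2l// Kr.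
Qed.

Lemma cone_gauge_sep k : K k -> cone_gauge (k - q) <= - r.
Proof.
move=> Kk; apply: le_trans (cone_gauge_le _ ler01 Kk) _.
by rewrite scale1r subrr normr0 mul1r sub0r.
Qed.

End cone_gauge.

(** Expresses {cone_gauge < c} as a set K being hit by an open set, which is a
    measurable condition on a random set K. *)
Lemma cone_gauge_ltE (R : realType) (E : normedModType R) (K : set E) (q : E) (r : R) x c :
  K !=set0 -> (forall k, K k -> r <= `|k - q|) ->
  cone_gauge K q r x < c <->
  exists k, K k /\ exists2 t, 0 <= t & `|x - t *: (k - q)| - t * r < c.
Proof.
move=> K0 Kr; split=> [/inf_lt|[k [Kk [t t0 tc]]]]; last first.
  exact: le_lt_trans (cone_gauge_le Kr x t0 Kk) tc.
case; first exact: cone_gauge_set_neq0.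
by move=> _ [t [k [t0 Kk ->]]] tc; exists k; split => //; exists t.
Qed.

(** * A random closed convex set as an intersection of random half-spaces *)

Section halfspace_representation.
Context (R : realType) (E : completeNormedModType R) (hE : separable_space E).
Context d (Omega : measurableType d) (P : probability Omega R).
Hypothesis hP : measure_is_complete P.
Variable X : Omega -> set E.
Hypotheses (hX : random_set measurable X) (hXne : {ae P, forall w, X w !=set0})
  (hXcl : {ae P, forall w, closed (X w)})
  (hXcv : {ae P, forall w, convex_set (X w)}).

Lemma measurable_hit (U : set E) : open U ->
  measurable [set w | (X w `&` U) !=set0].
Proof.
move=> oU; apply: (measurable_projection hE hP).
rewrite /random_set (_ : [set p | _] = [set p | X p.1 p.2] `&`
  ([set: g_sigma_algebraType (@measurable _ Omega)] `*` (U : set (borel E)))).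
  apply: measurableI => //; apply: measurableX => //.
  exact: sub_sigma_algebra.
by apply/seteqP; split=> [p []|p [? []]].
Qed.

Lemma continuous_ltr_open (f : E -> R) c : continuous f -> open [set x | f x < c].
Proof.
move=> cf; rewrite (_ : [set x | f x < c] = f @^-1` [set t | t < c])//.
by apply: open_comp => [x _|]; [exact: cf|exact: open_lt].
Qed.

(** On the event G that X is non-empty, convex and at distance at least r from q,
    a linear minorant of the gauge is taken; elsewhere the norm is used in place of
    the gauge, to have a sublinear functional for every w. *)
Lemma measurable_separation (q : E) (r : R) : 0 <= r ->
  exists zeta : Omega -> dual E, [/\ L0_dual measurable zeta,
    forall w x, zeta w x <= `|x| &
    {ae P, forall w, (forall k, X w k -> r <= `|k - q|) ->
      forall k, X w k -> zeta w k <= zeta w q - r}].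
Proof.
move=> r0.
pose C := [set w | X w !=set0 /\ convex_set (X w)].
pose G := C `&` ~` [set w | (X w `&` [set k | `|k - q| < r]) !=set0].
have aeC : {ae P, forall w, C w} by apply: filterS2 hXne hXcv => w; split.
have mG : measurable G.
  apply: measurableI; first exact: (ae_measurable hP).
  apply/measurableC/measurable_hit/continuous_ltr_open => x.
  by apply: cvg_norm; apply: cvgB; [exact: cvg_id|exact: cvg_cst].
have GP w : G w -> forall k, X w k -> r <= `|k - q|.
  by move=> [_ nG] k Xk; rewrite leNgt; apply/negP => kq; apply: nG; exists k.
pose p w x := if w \in G then cone_gauge (X w) q r x else `|x|.
have pG w : G w -> p w = cone_gauge (X w) q r.
  by move=> Gw; apply/funext => x; rewrite /p mem_set.
have pN w : ~ G w -> p w = Num.norm by move=> nG; apply/funext => x; rewrite /p memNset.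
have sp w : sublinear (p w).
  have [Gw|nG] := pselect (G w); [rewrite pG//|rewrite pN//].
    by apply: sublinear_cone_gauge (GP w Gw) _; case: (Gw) => -[].
  by split=> [x y|t x t0]; [exact: ler_normD|rewrite normrZ ger0_norm].
have p_norm w x : p w x <= `|x|.
  have [Gw|nG] := pselect (G w); [rewrite pG//|by rewrite pN].
  by apply: cone_gauge_norm (GP w Gw) _; case: (Gw) => -[].
have [s sP] := separable_seq hE.
have mp x : measurable_fun [set: Omega] (p^~ x).
  apply: (measurability _ (RGenInftyO.measurableE R)) => _ [_ [c ->] <-].
  rewrite setTI.
  pose V t := [set k | `|x - t *: (k - q)| - t * r < c].
  rewrite (_ : _ @^-1` _ =
    (G `&` [set w | (X w `&` \bigcup_(t in [set t | 0 <= t]) V t) !=set0]) `|`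
    (~` G `&` [set _ | `|x| < c])).
    apply: measurableU; apply: measurableI => //.
    - apply: measurable_hit; apply: bigcup_open => t _.
      apply: continuous_ltr_open => k; apply: cvgB; last exact: cvg_cst.
      apply: cvg_norm; apply: cvgB; first exact: cvg_cst.
      by apply: cvgZr; apply: cvgB; [exact: cvg_id|exact: cvg_cst].
    - exact: measurableC.
    - have [xc|xc] := boolP (`|x| < c).
        by rewrite (_ : [set _ | _] = setT)//; apply/seteqP; split.
      by rewrite (_ : [set _ | _] = set0)//; apply/seteqP; split.
  have gE w : G w -> cone_gauge (X w) q r x < c <->
      exists k, X w k /\ exists2 t, 0 <= t & V t k.
    by move=> Gw; apply: cone_gauge_ltE (GP w Gw); case: (Gw) => -[].
  apply/seteqP; split=> w /=; rewrite in_itv /=.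
    have [Gw|nG] := pselect (G w); [rewrite pG// => /(gE w Gw)|rewrite pN// => xc].
      by move=> [k [Xk [t t0 Vk]]]; left; split => //; exists k; split => //; exists t.
    by right.
  case=> [[Gw [k [Xk [t t0 Vk]]]]|[nG xc]].
    by rewrite pG//; apply/(gE w Gw); exists k; split => //; exists t.
  by rewrite pN.
have [zeta [mz zp]] := measurable_hahn_banach sp p_norm sP mp.
exists zeta; split.
- move=> x _ Y mY; have := mz x measurableT Y mY.
  by rewrite !setTI (sub_measurableE (sub_sigma_algebra_self _)).
- by move=> w x; apply: le_trans (zp w x) _.
apply: filterS aeC => w Cw far k Xk.
have Gw : G w.
  by split => // -[l [/far + /=]]; rewrite ltNge => ->.
rewrite -lerBlDl -linearB; apply: le_trans (zp _ _) _.
rewrite pG//; exact: cone_gauge_sep (GP w Gw) _ Xk.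
Qed.

(** A point x outside the closed set X w is close to some q j, at a distance less
    than some 1/(m+1) that is still at most the distance of q j to X w; the
    functional separating q j from X w by 1/(m+1) then separates x as well. *)
Lemma random_halfspaces : exists zeta : nat -> Omega -> dual E,
  (forall n, L0_dual measurable (zeta n)) /\
  {ae P, forall w, X w = \bigcap_n
    [set x | ((zeta n w x)%:E <= support (X w) (zeta n w))%E]}.
Proof.
have [q qP] := separable_seq hE.
have /choice[zeta zetaP] : forall n, exists zeta : Omega -> dual E,
  [/\ L0_dual measurable zeta, forall w x, zeta w x <= `|x| &
    {ae P, forall w,
      (forall k, X w k -> (natpair n).2.+1%:R^-1 <= `|k - q (natpair n).1|) ->
      forall k, X w k ->
        zeta w k <= zeta w (q (natpair n).1) - (natpair n).2.+1%:R^-1}].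
  by move=> n; apply: measurable_separation; rewrite invr_ge0 ler0n.
exists zeta; split; first by move=> n; case: (zetaP n).
have sep : {ae P, forall w, forall n,
      (forall k, X w k -> (natpair n).2.+1%:R^-1 <= `|k - q (natpair n).1|) ->
      forall k, X w k ->
        zeta n w k <= zeta n w (q (natpair n).1) - (natpair n).2.+1%:R^-1}.
  by apply: ae_foralln => n; case: (zetaP n).
apply: filterS2 hXcl sep => w cX {}sep; apply/seteqP; split=> [x Xx n _ /=|x xP].
  by apply: ereal_sup_ubound; exists x.
apply: closed_approx => // e e0; apply: contrapT => nX.
have far k : X w k -> e <= `|x - k|.
  by move=> Xk; rewrite leNgt; apply/negP => xk; apply: nX; exists k.
have [m /(_ m (leqnn m)) mP] := natSinv_lt (divr_gt0 e0 (ltr0Sn R 1)).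
have [j xj] := qP x m.+1%:R^-1 (eqbRL (invr_gt0 _) (ltr0Sn R m)).
pose n : nat := pickle (j, m).
have := sep n; rewrite /n natpairK /= -/n => sepn.
have {}sepn k : X w k -> zeta n w k <= zeta n w (q j) - m.+1%:R^-1.
  apply: sepn => l /far xl; have := ler_distD (q j) x l.
  rewrite [`|q j - l|]distrC; move: mP xj xl.
  by move: `|x - l| `|x - q j| `|l - q j| (m.+1%:R^-1) => a b c r; lra.
have : ((zeta n w x)%:E <= (zeta n w (q j) - m.+1%:R^-1)%:E)%E.
  apply: le_trans (xP n I) _; apply: ge_ereal_sup => _ [k Xk <-].
  by rewrite lee_fin; exact: sepn.
rewrite lee_fin lerBrDr -lerBrDl -linearB => rz.
have [_ /(_ w (q j - x)) zx _] := zetaP n.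
by have := lt_le_trans xj (le_trans rz zx); rewrite distrC ltxx.
Qed.

End halfspace_representation.

(** * Weakly compact convex sets *)

Section weak_compactness.
Context (R : realType) (E : completeNormedModType R).

Definition weak := initial_topology
  (fun x : E => (fun u => u x) : {ptws dual E -> R^o}).

Lemma continuous_weak_eval (u : dual E) : continuous ((fun x => u x) : weak -> R^o).
Proof.
move=> x; apply: (@continuous_comp _ _ _
  ((fun x : E => (fun u => u x) : {ptws dual E -> R^o}) : weak -> _) (proj u)).
  exact: initial_continuous.
exact: proj_continuous.
Qed.

Lemma continuous_big_sum (T : topologicalType) (I : Type) (s : seq I)
    (f : I -> T -> R) :
  (forall i, continuous (f i)) -> continuous (fun y => \sum_(i <- s) f i y).
Proof.
move=> cf; elim: s => [|i s IHs].
  rewrite (_ : (fun y => _) = (fun=> 0)); first exact: cst_continuous.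
  by apply/funext => y; rewrite big_nil.
rewrite (_ : (fun y => _) = (fun y => f i y + \sum_(j <- s) f j y)).
  by move=> x; apply: cvgD; [exact: cf|exact: IHs].
by apply/funext => y; rewrite big_cons.
Qed.

Lemma continuous_weak_sum (s : seq (dual E)) (g : dual E -> R -> R) :
  (forall u, continuous (g u)) ->
  continuous ((fun y => \sum_(u <- s) g u (u y)) : weak -> R).
Proof.
move=> cg; apply: (@continuous_big_sum weak _ s (fun u y => g u (u y))) => u y.
exact: (continuous_comp (@continuous_weak_eval u y) (cg u (u y))).
Qed.

Lemma rat_subspace_sum (U : set (dual E)) (s : seq (dual E)) (c : dual E -> rat) v :
  rat_subspace U -> U v -> (forall u, u \in s -> U u) ->
  exists2 w, U w & forall x, w x = \sum_(u <- s) ratr (c u) * u x.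
Proof.
move=> hU Uv; elim: s => [|u s IHs] Us.
  have [w Uw wP] := hU (-1) v v Uv Uv.
  by exists w => // x; rewrite big_nil wP rmorphN1 mulN1r addNr.
have [|w Uw wP] := IHs; first by move=> t ts; apply: Us; rewrite in_cons ts orbT.
have [t Ut tP] := hU (c u) u w (Us u (mem_head _ _)) Uw.
by exists t => // x; rewrite tP big_cons wP.
Qed.

Lemma rat_approx (c e : R) : 0 < e -> exists q : rat, `|ratr q - c| <= e.
Proof.
rewrite -(ltrDl c) => /rat_in_itvoo[q]; rewrite in_itv /= => /andP[cq qc].
by exists q; rewrite ger0_norm ?subr_ge0 ?ltW// ltrBlDl.
Qed.

(** By compactness finitely many elements u of U distinguish x from every point of K.
    The weakly continuous function y |-> \sum (u y - u x)^2 has a minimum del > 0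
    on K, at y0 say; with c u := u y0 - u x, convexity of K gives the variational
    inequality \sum c u * (u y - u x) >= del on K.  Hence - \sum c u * u separates
    strictly, and since the differences u y - u x are bounded on K, the
    coefficients can be replaced by rational ones. *)
Lemma weak_compact_separation (U : set (dual E)) (K : set E) x :
  total U -> rat_subspace U -> K !=set0 -> weakly_compact K -> convex_set K ->
  ~ K x -> exists2 u, U u & exists2 e : R, 0 < e & forall y, K y -> u y <= u x - e.
Proof.
move=> tU rU K0 cK vK nKx.
have [s Us sP] : exists2 s : seq (dual E), (forall u, u \in s -> U u) &
    forall y, K y -> exists2 u, u \in s & u y != u x.
  move: cK; rewrite /weakly_compact compact_cover.
  move=> /(_ _ U (fun u => [set y | u y != u x]))[].
  - move=> u Uu; rewrite (_ : [set y | _] =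
      ((fun x => u x) : weak -> R^o) @^-1` [set t | t != u x])//.
    apply: open_comp; first by move=> y _; exact: continuous_weak_eval.
    exact: open_neq.
  - move=> y Ky; apply: contrapT => nU; apply: nKx.
    rewrite (_ : x = y)//; apply: tU => u Uu; apply: contrapT => uxy.
    by apply: nU; exists u => //=; apply/eqP => /esym.
  move=> D DU KD; exists (finmap.enum_fset D) => [u /DU|y /KD[u uD uy]]; first by rewrite inE.
  by exists u.
have cc (g : dual E -> R -> R) : (forall u, continuous (g u)) ->
    {within (K : set weak), continuous (fun y => \sum_(u <- s) g u (u y))}.
  by move=> cg; apply: continuous_subspaceT; exact: continuous_weak_sum.
have cB (u : dual E) : continuous (fun t : R => t - u x).
  by move=> t; apply: cvgB; [exact: cvg_id|exact: cvg_cst].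
have cQ (u : dual E) : continuous (fun t : R => (t - u x) * (t - u x)).
  by move=> t; apply: cvgM; exact: cB.
have [y0 /set_mem Ky0 y0min] :=
  @compact_EVT_min weak R _ K K0 cK (cc _ cQ).
have [y1 /set_mem Ky1 y1max] :=
  @compact_EVT_max weak R _ K K0 cK (cc _ (fun u t => cvg_norm (cB u t))).
pose c (u : dual E) : R := u y0 - u x.
pose del : R := \sum_(u <- s) c u * c u.
pose B : R := \sum_(u <- s) `|u y1 - u x|.
have del0 : 0 < del.
  have [u us uy0] := sP y0 Ky0.
  rewrite /del (big_rem u us) /=; apply: ltr_pwDl.
    by rewrite -expr2 exprn_even_gt0// subr_eq0.
  by apply: sumr_ge0 => v _; rewrite -expr2 sqr_ge0.
have B0 : 0 <= B by exact: sumr_ge0.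
have cdel y : K y -> del <= \sum_(u <- s) c u * (u y - u x).
  move=> Ky; pose b (u : dual E) : R := u y - u y0.
  pose S : R := \sum_(u <- s) c u * b u; pose Q : R := \sum_(u <- s) b u * b u.
  have Q0 : 0 <= Q by apply: sumr_ge0 => v _; rewrite -expr2 sqr_ge0.
  rewrite (_ : \sum_(u <- s) _ = del + S); last first.
    rewrite /del /S -big_split /=; apply: eq_bigr => u _.
    by rewrite /c /b; ring.
  rewrite lerDl leNgt; apply/negP => S0.
  have quad t : 0 <= t -> t <= 1 -> 0 <= t * (2 * S + t * Q).
    move=> t0 t1.
    have Kt : K ((1 - t) *: y0 + t *: y).
      by apply: convex_setP => //; rewrite ?subr_ge0// subrK.
    have := y0min _ (mem_set Kt); rewrite -subr_ge0; congr (0 <= _).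
    rewrite -sumrB [2 * S]mulr_sumr [t * Q]mulr_sumr -big_split /= mulr_sumr.
    apply: eq_bigr => u _; rewrite linearD !linearZ /= /c /b /GRing.scale /=; ring.
  (* Chosen so that 0 < t <= 1 and t * Q <= - S, against 0 <= 2 * S + t * Q. *)
  pose t := - S / (Q + 1 - S).
  have den0 : 0 < Q + 1 - S by lra.
  have t0 : 0 < t by rewrite divr_gt0// oppr_gt0.
  have t1 : t <= 1 by rewrite ler_pdivrMr// mul1r; lra.
  have := quad t (ltW t0) t1; rewrite pmulr_rge0// leNgt => /negP; apply.
  have : t * Q <= - S.
    rewrite /t mulrAC ler_pdivrMr// ler_wpM2l//; first by rewrite oppr_ge0 ltW.
    by lra.
  by lra.
(* The error of the rational coefficients: it costs e * B <= del / 2 on K. *)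
pose e := del / (2 * (B + 1)).
have e0 : 0 < e by rewrite divr_gt0// mulr_gt0// ltr_wpDl.
have /choice[qf qfP] : forall u, exists q : rat, `|ratr q - (- c u)| <= e.
  by move=> u; exact: rat_approx.
have [v Uv] : U !=set0.
  by case: K0 => y /sP[u /Us Uu _]; exists u.
have [w Uw wP] := rat_subspace_sum qf rU Uv Us.
exists w => //; exists (del / 2); first by rewrite divr_gt0.
move=> y Ky.
have wE : w y - w x = \sum_(u <- s) (ratr (qf u) + c u) * (u y - u x) -
    \sum_(u <- s) c u * (u y - u x).
  by rewrite !wP -!sumrB; apply: eq_bigr => u _; ring.
have wle : \sum_(u <- s) (ratr (qf u) + c u) * (u y - u x) <= e * B.
  apply: (@le_trans _ _ (\sum_(u <- s) e * `|u y - u x|)).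
    apply: ler_sum => u _; apply: le_trans (ler_norm _) _; rewrite normrM.
    by apply: ler_wpM2r => //; have := qfP u; rewrite opprK.
  rewrite -mulr_sumr; apply: ler_wpM2l; first exact: ltW.
  exact: (y1max y (mem_set Ky)).
have eB : e * B <= del / 2.
  rewrite /e mulrAC ler_pdivrMr; last by rewrite mulr_gt0// ltr_wpDl.
  rewrite (_ : del / 2 * (2 * (B + 1)) = del * (B + 1)); last by field.
  by rewrite ler_pM2l// lerDl.
rewrite -[w y](subrK (w x)) addrC lerD2l wE.
by apply: le_trans (lerB wle (cdel y Ky)) _; lra.
Qed.
End weak_compactness.

(** * The core of a weakly compact random set *)

Lemma dual_comb (R : realType) (E : normedModType R) (c : R) (u v : dual E) :
  exists w : dual E, forall x, w x = c * u x + v x.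
Proof.
apply: (@continuous_linear_dual R E (fun x => c * u x + v x : R^o)) => [t x y|x].
  rewrite /= !linearD !linearZ /= mulrDr addrACA; congr (_ + _).
apply: cvgD; last exact: dual_continuous.
by apply: cvgM; [exact: cvg_cst|exact: dual_continuous].
Qed.

(** Indexing the rational combinations by finite lists of coefficients and indices
    makes countability immediate. *)
Lemma rat_span (R : realType) (E : normedModType R) (U : set (dual E)) :
  countable U -> total U ->
  exists V : set (dual E), [/\ countable V, total V & rat_subspace V].
Proof.
move=> /pfcard_geP[-> tU|[f] tU]; first by exists set0; split.
pose comb (s : seq (rat * nat)) x := \sum_(c <- s) ratr c.1 * f c.2 x.
have /choice[F FE] : forall s, exists v : dual E, forall x, v x = comb s x.
  elim=> [|c s [v vE]].
    have [w wE] := dual_comb (-1) (f 0%N) (f 0%N).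
    by exists w => x; rewrite wE mulN1r addNr /comb big_nil.
  have [w wE] := dual_comb (ratr c.1) (f c.2) v.
  by exists w => x; rewrite wE vE /comb big_cons.
exists (range F); split.
- exact: (card_le_trans (card_image_le _ _) (countableP _)).
- move=> x y xy; apply: tU => u Uu; have [n _ <-] := @surj _ _ _ _ f u Uu.
  have := xy (F [:: (1, n)]); rewrite !FE /comb !big_seq1 /= rmorph1 !mul1r.
  by apply; exists [:: (1, n)].
- move=> q _ _ [s _ <-] [t _ <-].
  exists (F ([seq (q * c.1, c.2) | c <- s] ++ t)); first by exists ([seq (q * c.1, c.2) | c <- s] ++ t).
  move=> x; rewrite !FE /comb big_cat /= big_map mulr_sumr; congr (_ + _).
  by apply: eq_bigr => c _; rewrite rmorphM mulrA.
Qed.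

Lemma countable_range (I : Type) (U : set I) : countable U ->
  U = set0 \/ exists f : nat -> I, U = range f.
Proof.
move=> /pfcard_geP[->|[f]]; first by left.
right; exists f; apply/seteqP; split=> [u /(@surj _ _ _ _ f)//|_ [n _ <-]].
exact: funS.
Qed.

Lemma ae_forall_countable d (T : measurableType d) (R : realType)
    (mu : measure T R) (I : Type) (U : set I) (Q : I -> T -> Prop) :
  countable U -> (forall u, U u -> {ae mu, forall w, Q u w}) ->
  {ae mu, forall w, forall u, U u -> Q u w}.
Proof.
move=> /countable_range[->|[f ->]] aeQ.
  by apply: filterE => w u [].
have : {ae mu, forall w, forall n, Q (f n) w}.
  by apply: ae_foralln => n; apply: aeQ; exists n.
by apply: filterS => w Qf _ [n _ <-].
Qed.

Lemma countable_bigcap_measurable d (T : measurableType d) (I : Type)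
    (U : set I) (F : I -> set T) :
  countable U -> (forall u, measurable (F u)) -> measurable (\bigcap_(u in U) F u).
Proof.
move=> /countable_range[->|[f ->]] mF; first by rewrite bigcap_set0.
by rewrite bigcap_image; exact: bigcapT_measurable.
Qed.

Section weakly_compact_core.
Context (R : realType) (E : completeNormedModType R) (hE : separable_space E).
Context d (Omega : measurableType d) (P : probability Omega R).
Context (H : set (set Omega)) (hH : sub_sigma_algebra_of H).
Variables (X M : Omega -> set E).
Hypotheses (hM : is_cond_core P H X M) (hXne : {ae P, forall w, X w !=set0})
  (hXcl : {ae P, forall w, closed (X w)})
  (hXcv : {ae P, forall w, convex_set (X w)}).
Variable e : dual E -> Omega -> \bar R.
Hypothesis he : forall u, is_cond_essinf P H (fun w => support (X w) u) (e u).

Lemma core_subset_halfspace (u : dual E) :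
  {ae P, forall w, M w `<=` [set x | ((u x)%:E <= e u w)%E]}.
Proof.
have [mM MX _] := hM.
have cst_L0 : L0_dual H (cst u : Omega -> dual E).
  by move=> x; exact: measurable_cst.
have := support_subset_essinf hE hH mM MX cst_L0 (he u).
apply: filterS => w + x Mx /=; apply: le_trans.
by apply: ereal_sup_ubound; exists x.
Qed.

(** A selection of the intersection satisfies u g <= essinf_H h_X(u) <= h_X(u) for
    all u in U, which places it in X because U separates points from weakly
    compact convex sets. *)
Lemma core_eq_bigcap_halfspaces (U : set (dual E)) :
  countable U -> total U -> rat_subspace U ->
  {ae P, forall w, weakly_compact (X w)} ->
  {ae P, forall w, M w = \bigcap_(u in U) [set x | ((u x)%:E <= e u w)%E]}.
Proof.
move=> cU tU rU hXwc.
have me (u : dual E) : measurable [set p : g_sigma_algebraType H * borel E |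
    ((u p.2)%:E <= e u p.1)%E].
  rewrite -[X in measurable X]setTI; apply: measurable_lee => //.
    apply/measurable_EFinP; apply: (measurable_dual_eval hE (zeta := cst u)).
    by move=> x; exact: measurable_cst.
  by apply: measurable_fun_fst_comp => //; case: (he u).
have mU : random_set H (fun w => \bigcap_(u in U) [set x | ((u x)%:E <= e u w)%E]).
  exact: (countable_bigcap_measurable cU me).
have sub : {ae P, forall w, forall u, U u ->
    M w `<=` [set x | ((u x)%:E <= e u w)%E]}.
  by apply: ae_forall_countable => // u _; exact: core_subset_halfspace.
have essinf_le : {ae P, forall w, forall u, U u -> (e u w <= support (X w) u)%E}.
  by apply: ae_forall_countable => // u _; case: (he u).
have inX : {ae P, forall w x,
    (forall u, U u -> ((u x)%:E <= support (X w) u)%E) -> X w x}.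
  apply: filterS3 hXne hXcv hXwc => w X0 Xv Xc x xU; apply: contrapT => nXx.
  have [u Uu [r r0 ur]] := weak_compact_separation tU rU X0 Xc Xv nXx.
  have : ((u x)%:E <= (u x - r)%:E)%E.
    apply: le_trans (xU u Uu) _; apply: ge_ereal_sup => _ [y Xy <-].
    by rewrite lee_fin; exact: ur.
  by rewrite lee_fin lerBrDl gerDr leNgt r0.
have sup := core_contains hE hH hM mU hXcl.
have {}sup : {ae P, forall w,
    \bigcap_(u in U) [set x | ((u x)%:E <= e u w)%E] `<=` M w}.
  apply: sup => D g HD mg Dg; apply: filterS2 essinf_le inX => w ew Xw Dw.
  by apply: Xw => u Uu; apply: le_trans (ew u Uu); exact: Dg.
apply: filterS2 sub sup => w {}sub {}sup.
by apply/seteqP; split => // x Mx u Uu; exact: sub.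
Qed.

End weakly_compact_core.

(** * The conditional core as an intersection of half-spaces *)

Theorem theorem4p12
    (R : realType) (E : completeNormedModType R) (hE : separable_space E)
    (d : measure_display) (Omega : measurableType d) (P : probability Omega R)
    (hP : measure_is_complete P)
    (H : set (set Omega)) (hH : sub_sigma_algebra_of H)
    (U0 : set (dual E)) (hU0c : countable U0) (hU0t : total U0)
    (X : Omega -> set E) (hX : random_set measurable X)
    (hXne : {ae P, forall w, X w !=set0})
    (hXcl : {ae P, forall w, closed (X w)})
    (hXcv : {ae P, forall w, convex_set (X w)})
    (M : Omega -> set E) (hM : is_cond_core P H X M) :
  [/\ (forall (zeta : Omega -> dual E) (e : Omega -> \bar R),
         L0_dual H zeta ->
         is_cond_essinf P H (fun w => support (X w) (zeta w)) e ->
         {ae P, forall w, (support (M w) (zeta w) <= e w)%E}),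

      (forall phi : (Omega -> dual E) -> Omega -> E -> \bar R,
         (forall zeta, L0_dual measurable zeta ->
            is_cond_essinf_field P H
              (fun w x => support (X w) (zeta w) - (zeta w x)%:E)%E
              (phi zeta)) ->
         is_ae_bigcap P (L0_dual measurable)
           (fun zeta w => [set x | (0 <= phi zeta w x)%E]) M),

      (forall zeta : nat -> Omega -> dual E,
         (forall n, L0_dual measurable (zeta n)) ->
         {ae P, forall w, X w =
            \bigcap_n [set x | ((zeta n w x)%:E <= support (X w) (zeta n w))%E]} ->
         forall phi : nat -> Omega -> E -> \bar R,
         (forall n, is_cond_essinf_field P H
            (fun w x => support (X w) (zeta n w) - (zeta n w x)%:E)%E
            (phi n)) ->
         {ae P, forall w, M w = \bigcap_n [set x | (0 <= phi n w x)%E]}) &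

      ({ae P, forall w, weakly_compact (X w)} ->
       forall e : dual E -> Omega -> \bar R,
         (forall u, is_cond_essinf P H (fun w => support (X w) u) (e u)) ->
         (rat_subspace U0 ->
          {ae P, forall w,
             M w = \bigcap_(u in U0) [set x | ((u x)%:E <= e u w)%E]}) /\
         is_ae_bigcap P [set: dual E]
           (fun u w => [set x | ((u x)%:E <= e u w)%E]) M)].

Proof.
have [mM MX _] := hM.
have part3 := core_eq_bigcap_fields hE hH hM hXcl.
have part4 := core_eq_bigcap_halfspaces hE hH hM hXne hXcl hXcv.
split.
- by move=> zeta e mz he; exact: support_subset_essinf he.
- move=> phi hphi; split=> [zeta mz|].
    exact: (subset_essinf_field hE hH mM MX (hphi zeta mz)).
  have [zeta [mz XE]] := random_halfspaces hE hP hX hXne hXcl hXcv.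
  exists (range zeta); split.
  + exact: (card_le_trans (card_image_le _ _) (countableP _)).
  + by move=> _ [n _ <-].
  + have := part3 zeta (fun n => phi (zeta n)) XE (fun n => hphi _ (mz n)).
    by apply: filterS => w ->; rewrite bigcap_image.
- by move=> zeta mz XE phi hphi; exact: part3 XE hphi.
move=> hXwc e he; split=> [rU0|]; first exact: part4.
split=> [u _|]; first exact: (core_subset_halfspace hE hH hM he).
have [V [cV tV rV]] := rat_span hU0c hU0t.
exists V; split => //.
by apply: filterS (part4 e he V cV tV rV hXwc) => w ->.
Qed.
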